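(* Let $k\ge 1$ and let $M_1,M_2$ be $k\times k$ matrices with integer entries such that $M_1$, $M_2$ and $M_1-M_2$ are invertible (i.e., have nonzero determinant). For any $\alpha,\epsilon>0$ there exists $N_0=N_0(\alpha,\epsilon,M_1,M_2)$ such that the following holds. If $N\ge N_0$, then for any $A\subseteq [N]^k$ with $|A|\ge \alpha N^k$ there is a vector $\vec d\in\mathbb{Z}^k$, $\vec d\neq 0$, such that \[\#\{\vec x\in [N]^k:\ \vec x,\ \vec x+M_1\vec d,\ \vec x+M_2\vec d\in A\}\ \ge\ (\alpha^3-\epsilon)N^k.\]
   Context: $[N]=\{1,2,\ldots,N\}$, and $[N]^k\subseteq\mathbb{Z}^k$; matrices act on column vectors in $\mathbb{Z}^k$ by matrix multiplication. *)

(* Defs.v *)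
From mathcomp Require Import all_boot all_order all_algebra.
From mathcomp Require Import finmap reals.

Set Implicit Arguments.
Unset Strict Implicit.
Unset Printing Implicit Defensive.

Import Order.TTheory GRing.Theory Num.Theory.
Local Open Scope fset_scope.
Local Open Scope ring_scope.

(* [N]^k = {1, ..., N}^k; the + 1 shifts 'I_N = {0, ..., N - 1}. *)
Definition cube (k N : nat) : {fset 'cV[int]_k} :=
  [fset \col_(i < k) ((f i).+1)%:Z | f : {ffun 'I_k -> 'I_N} in predT].

Lemma in_cube (k N : nat) (x : 'cV[int]_k) :
  (x \in cube k N) = [forall i, (1 <= x i 0) && (x i 0 <= N%:Z)].
Proof.
apply/imfsetP/forallP => [[f _ ->] i | xP].
  by rewrite mxE !lez_nat /= ltn_ord.
have ltx i : (`|x i 0%R|.-1 < N)%N.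
  by have := xP i; case: (x i 0) => [[|n]|n] //=; rewrite !lez_nat.
exists [ffun i => Ordinal (ltx i)] => //.
apply/colP => i; rewrite mxE ffunE /=.
by have := xP i; case: (x i 0) => [[|n]|n].
Qed.

(* Main.v *)
(** Reduce modulo [Q = c N + 1], coprime to the three determinants, and let [f]
    be the indicator function of [A] in [(Z/Q)^k].  For a finite set [P] of
    frequencies the kernel [|P|^-1 |sum_(xi in P) e(xi . x)|^2] is nonnegative of
    mean 1, and its coefficient at [xi] is [|P :&: (P + xi)| / |P|].  If [P] is a
    Folner set for a set [S] of frequencies, this is close to 1 on [S], and it
    vanishes outside [P - P].

    Let [f_P] be the convolution of [f] with this kernel.  An energy increment
    gives [P] and [P1] of bounded size with [f_P1 - f_P] small in L^2 and the
    Fourier coefficients of [f - f_P1] as small as we like in terms of [P].  Draw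
    [d] from the kernel of a Folner set [W] for the frequencies [M_i^T (P - P)].
    Then [f_P] is almost invariant under translation by [M_i d], the uniform part
    does not contribute by Cauchy-Schwarz (this uses that [M1], [M2] and
    [M1 - M2] are invertible), and the average number of patterns is about
    [E f_P^3], which is at least [alpha^3] times the density of the cube by
    convexity.  Putting the basis frequencies in all these sets makes [d] small,
    so that the patterns found modulo [Q] are patterns in [Z^k]. *)
Require Import Defs.
From mathcomp Require Import all_boot all_order all_algebra.
From mathcomp Require Import finmap reals trigo.
From mathcomp Require Import ring lra zify.

Set Implicit Arguments.
Unset Strict Implicit.
Unset Printing Implicit Defensive.

Import Order.TTheory GRing.Theory Num.Theory.
Local Open Scope fset_scope.
Local Open Scope ring_scope.

(** * Folner sets in finite abelian groups *)

(** By Bernoulli, [(1 + 1/m)^q >= q/m]. Its power [n + 1] has one degree more in [q] than the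
    polynomial side at [L = q * (n + 1)]. *)
Lemma expn_beats_poly (n m : nat) : (0 < m)%N ->
  exists L : nat, ((L.+1) ^ n * m ^ L < (m.+1) ^ L)%N.
Proof.
move=> m0.
have bern q : (m ^ q * (m + q) <= m.+1 ^ q * m)%N.
  elim: q => [|q IH]; first by rewrite addn0.
  by rewrite !expnS; nia.
(* [q] must exceed [m^(n+1)], lost in Bernoulli, times [(n+2)^n], lost in bounding [L + 1] by
   [(n + 2) * q]. *)
pose q := ((m ^ n.+1 * n.+2 ^ n).+1)%N; exists (q * n.+1)%N.
have h1 : (m ^ (q * n.+1) * q ^ n.+1 <= m.+1 ^ (q * n.+1) * m ^ n.+1)%N.
  rewrite !expnM -!expnMn leq_exp2r //; apply: leq_trans (bern q).
  by rewrite leq_mul2l leq_addl orbT.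
have h2 : ((q * n.+1).+1 ^ n <= n.+2 ^ n * q ^ n)%N.
  rewrite -expnMn; case: (posnP n) => [->//|n0].
  by rewrite leq_exp2r // mulSnr mulnC; rewrite /q; lia.
have h3 : (m ^ n.+1 * (n.+2 ^ n * q ^ n) < q ^ n.+1)%N.
  by rewrite mulnA [(q ^ n.+1)%N]expnS ltn_pmul2r // expn_gt0.
have e0 : (0 < m ^ n.+1)%N by rewrite expn_gt0 m0.
rewrite -(ltn_pmul2r e0); apply: leq_trans h1.
rewrite mulnAC mulnC ltn_pmul2l ?expn_gt0 ?m0 //.
apply: leq_ltn_trans h3; rewrite mulnC leq_mul2l h2; exact: orbT.
Qed.

Definition progression (G : finZmodType) (S : {set G}) (L : nat) : {set G} :=
  [set \sum_(i < #|S|) enum_val i *+ f i | f : {ffun 'I_#|S| -> 'I_L.+1}].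

(* Multidimensional progressions with steps in [S] have polynomial growth, so
   one of them, of bounded length, hardly grows when its length increases. *)
Lemma folner (n m : nat) : exists C : nat,
  forall (G : finZmodType) (S : {set G}), (#|S| <= n)%N ->
  exists P : {set G}, [/\ (0 < #|P|)%N, (#|P| <= C)%N &
    forall s, s \in S -> (#|[set x in P | (x + s)%R \notin P]| * m <= #|P|)%N].
Proof.
case: (posnP m) => [->|m0].
  exists 1%N => G S _; exists [set 0]; rewrite cards1; split=> // s _.
  by rewrite muln0.
have [L0 hL0] := expn_beats_poly n m0.
exists (L0.+1 ^ n)%N => G S leSn.
pose p := progression S.
have szp L : (#|p L| <= L.+1 ^ n)%N.
  apply: leq_trans (leq_imset_card _ _) _.
  by rewrite card_ffun !card_ord leq_pexp2l.
have p0 L : (0 < #|p L|)%N.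
  by apply/card_gt0P; eexists; apply: (imset_f _ (x := [ffun=> ord0])).
have pS L : p L \subset p L.+1.
  apply/subsetP => _ /imsetP[f _ ->]; apply/imsetP.
  exists [ffun i => widen_ord (leqnSn _) (f i)] => //.
  by apply: eq_bigr => i _; rewrite ffunE.
have pD L s x : s \in S -> x \in p L -> x + s \in p L.+1.
  move=> sS /imsetP[f _ ->]; apply/imsetP.
  pose i0 := enum_rank_in sS s.
  have lt i : (f i + (i == i0) < L.+2)%N by have := ltn_ord (f i); lia.
  exists [ffun i => Ordinal (lt i)] => //.
  under [RHS]eq_bigr do rewrite ffunE /= mulrnDr.
  rewrite big_split /=; congr (_ + _).
  rewrite (bigD1 i0) //= eqxx mulr1n big1 ?addr0 ?enum_rankK_in //.
  by move=> i /negPf->; rewrite mulr0n.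
(* Pigeonhole over lengths: if each step below [L0] grew by a factor above [(m + 1) / m], the size
   at [L0] would break the polynomial bound [szp]. *)
have [/existsP[L]|/existsPn no] :=
  boolP [exists L : 'I_L0, (#|p L.+1| * m <= #|p L| * m.+1)%N].
  move=> slow; exists (p L); split=> //.
    apply: leq_trans (szp L) _.
    by case: (posnP n) => [->//|n0]; rewrite leq_exp2r // ltnS ltnW.
  move=> s sS.
  have : (#|[set x in p L | (x + s)%R \notin p L]| <= #|p L.+1 :\: p L|)%N.
    (* Translation by [s] injects the points that leave [p L] into [p L.+1 :\: p L]. *)
    rewrite -(card_imset _ (addIr s)); apply/subset_leq_card/subsetP.
    by move=> _ /imsetP[x + ->]; rewrite !inE => /andP[xp ->]; rewrite pD.
  rewrite cardsD (setIidPr (pS L)).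
  have := subset_leq_card (pS L); nia.
have grow L : (L <= L0)%N -> (m.+1 ^ L <= #|p L| * m ^ L)%N.
  elim: L => [|L IH] lL; first by rewrite muln1.
  have := no (Ordinal lL); rewrite -ltnNge /= => h.
  rewrite !expnS; apply: leq_trans (_ : m.+1 * (#|p L| * m ^ L) <= _)%N.
    by rewrite leq_mul2l IH ?orbT // ltnW.
  by rewrite !mulnA leq_mul2r mulnC ltnW ?orbT.
have := grow _ (leqnn _); rewrite leqNgt => /negP[].
by apply: leq_ltn_trans hL0; rewrite leq_mul2r szp orbT.
Qed.

(** * Averages and characters *)

Section Average.
Variables (R : realType).

Definition avg (U : finType) (f : U -> R) : R := #|U|%:R^-1 * \sum_x f x.

Variables (U V : finType).
Implicit Types f g : U -> R.

Lemma avgE f : avg f = #|U|%:R^-1 * \sum_x f x.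
Proof. by []. Qed.

Lemma eq_avg f g : f =1 g -> avg f = avg g.
Proof. by move=> fg; congr (_ * _); apply: eq_bigr. Qed.

Lemma avgD f g : avg (fun x => f x + g x) = avg f + avg g.
Proof. by rewrite /avg big_split mulrDr. Qed.

Lemma avgN f : avg (fun x => - f x) = - avg f.
Proof. by rewrite /avg sumrN mulrN. Qed.

Lemma avgB f g : avg (fun x => f x - g x) = avg f - avg g.
Proof. by rewrite avgD avgN. Qed.

Lemma avgZ c f : avg (fun x => c * f x) = c * avg f.
Proof. by rewrite /avg -mulr_sumr mulrCA. Qed.

Lemma avgZr c f : avg (fun x => f x * c) = avg f * c.
Proof. by rewrite /avg -mulr_suml mulrA. Qed.

Lemma avg_sum (I : finType) (P : pred I) (F : I -> U -> R) :
  avg (fun x => \sum_(i | P i) F i x) = \sum_(i | P i) avg (F i).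
Proof. by rewrite /avg exchange_big mulr_sumr. Qed.

Lemma avgC (F : U -> V -> R) :
  avg (fun x => avg (F x)) = avg (fun y => avg (F ^~ y)).
Proof. by rewrite {1 3}/avg -!mulr_sumr exchange_big mulrCA. Qed.

Lemma ler_avg f g : (forall x, f x <= g x) -> avg f <= avg g.
Proof. by move=> fg; rewrite ler_wpM2l ?invr_ge0 // ler_sum. Qed.

Lemma avg_ge0 f : (forall x, 0 <= f x) -> 0 <= avg f.
Proof. by move=> f0; rewrite mulr_ge0 ?invr_ge0 ?sumr_ge0. Qed.

Lemma ler_norm_avg f : `|avg f| <= avg (fun x => `|f x|).
Proof.
by rewrite normrM ger0_norm ?invr_ge0 // ler_wpM2l ?invr_ge0 ?ler_norm_sum.
Qed.

Lemma avg_cst c : (0 < #|U|)%N -> avg (fun _ : U => c) = c.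
Proof.
move=> U0; rewrite /avg sumr_const -[c *+ _]mulr_natl mulKf //.
by rewrite pnatr_eq0 -lt0n.
Qed.

Lemma reindex_avg (h : U -> U) f : injective h -> avg f = avg (f \o h).
Proof. by move=> hI; rewrite /avg (reindex_inj hI). Qed.

End Average.

Arguments avg {R U} f.

Notation "\E_ x F" := (avg (fun x => F))
  (at level 41, F at level 41, x at level 0, format "'[' \E_ x '/  '  F ']'").

(** * Additive characters of [Z/Q], with [Q = q + 2] *)

Section Characters.
Variables (R : realType) (q : nat).
Notation Z := 'I_q.+2.

Definition angle (n : nat) : R := (pi *+ 2) * (n%:R / q.+2%:R).

Lemma angleD m n : angle (m + n) = angle m + angle n.
Proof. by rewrite /angle -mulrDr -mulrDl -natrD. Qed.

Lemma angle_mod (n : nat) : angle n = angle (n %% q.+2) + pi *+ 2 *+ (n %/ q.+2).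
Proof.
rewrite {1}(divn_eq n q.+2) addnC angleD; congr (_ + _).
by rewrite /angle natrM mulfK ?pnatr_eq0 // mulr_natr.
Qed.

Lemma cos_angle_mod n : cos (angle (n %% q.+2)) = cos (angle n).
Proof. by rewrite (angle_mod n) (periodicn (@cosD2pi R)). Qed.

Lemma sin_angle_mod n : sin (angle (n %% q.+2)) = sin (angle n).
Proof. by rewrite (angle_mod n) (periodicn (@sinD2pi R)). Qed.

(** Real and imaginary parts of the standard character; all of the Fourier analysis is done with
    such pairs, so that it stays in [R]. *)
Definition zcos (a : Z) : R := cos (angle a).
Definition zsin (a : Z) : R := sin (angle a).

Lemma zcosD a b : zcos (a + b) = zcos a * zcos b - zsin a * zsin b.
Proof. by rewrite /zcos cos_angle_mod angleD cosD. Qed.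

Lemma zsinD a b : zsin (a + b) = zsin a * zcos b + zcos a * zsin b.
Proof. by rewrite /zsin sin_angle_mod angleD sinD. Qed.

Lemma zcos0 : zcos 0 = 1.
Proof. by rewrite /zcos /angle mul0r mulr0 cos0. Qed.

Lemma zsin0 : zsin 0 = 0.
Proof. by rewrite /zsin /angle mul0r mulr0 sin0. Qed.

Lemma zcos2Dzsin2 a : zcos a ^+ 2 + zsin a ^+ 2 = 1.
Proof. exact: cos2Dsin2. Qed.

Lemma zcosN a : zcos (- a) = zcos a.
Proof.
have := zcosD (- a) a; have := zsinD (- a) a; have := zcos2Dzsin2 a.
rewrite addNr zcos0 zsin0.
move: (zcos a) (zsin a) (zcos (- a)) (zsin (- a)) => c s c' s' h1 h2 h3.
have -> : c' = c * (c' * c - s' * s) + s * (s' * c + c' * s).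
  by rewrite -[LHS]mulr1 -h1; ring.
by rewrite -h2 -h3; ring.
Qed.

Lemma zsinN a : zsin (- a) = - zsin a.
Proof.
have := zcosD (- a) a; have := zsinD (- a) a; have := zcos2Dzsin2 a.
rewrite addNr zcos0 zsin0.
move: (zcos a) (zsin a) (zcos (- a)) (zsin (- a)) => c s c' s' h1 h2 h3.
have -> : s' = c * (s' * c + c' * s) - s * (c' * c - s' * s).
  by rewrite -[LHS]mulr1 -h1; ring.
by rewrite -h2 -h3; ring.
Qed.

Lemma pi2_itv (x : R) : 0 <= x <= 2^-1 -> pi *+ 2 * x \in `[0, pi].
Proof.
move=> /andP[x0 x1]; have pi0 := pi_gt0 R.
rewrite in_itv /= -mulr_natr -mulrA pmulr_rge0 // mulr_ge0 //=.
by rewrite -ler_pdivlMl // mulVf ?gt_eqF // -ler_pdivlMl // mulr1.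
Qed.

Lemma pi2_gt0 : 0 < pi *+ 2 :> R.
Proof. by rewrite mulr2n addr_gt0 ?pi_gt0. Qed.

(** Residues at distance at least [L] from 0: evenness folds the upper half of [Z/Q] onto the lower
    one, where the cosine decreases. *)
Lemma zcos_le (lam : R) (L : nat) (a : Z) :
  0 < lam -> lam <= 2^-1 -> lam * q.+2%:R <= L%:R ->
  (L <= a)%N -> (a <= q.+2 - L)%N -> zcos a <= cos (pi *+ 2 * lam).
Proof.
move=> lam0 lam2 hL La aL.
have Q0 : 0 < q.+2%:R :> R by rewrite ltr0n.
have pi0 := pi2_gt0.
have th (n : nat) : (L <= n)%N -> (n.*2 <= q.+2)%N ->
    cos (angle n) <= cos (pi *+ 2 * lam).
  move=> Ln nQ.
  have n1 : lam <= n%:R / q.+2%:R.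
    by rewrite ler_pdivlMr // (le_trans hL) // ler_nat.
  have n2 : n%:R / q.+2%:R <= 2^-1 :> R.
    rewrite ler_pdivrMr //; move: nQ; rewrite -(ler_nat R) -muln2 natrM.
    by move=> ?; lra.
  rewrite leNgt; apply/negP => lt.
  have : angle n < pi *+ 2 * lam.
    by rewrite -ltr_cos // pi2_itv // ?lam2 ?n2 ?andbT ltW // (lt_le_trans lam0).
  by rewrite /angle ltr_pM2l // ltNge n1.
have [le|gt] := leqP a.*2 q.+2; first exact: th.
have -> : zcos a = zcos (- a) by rewrite zcosN.
have va : ((- a : Z) = q.+2 - a :> nat)%N.
  by rewrite /= modn_small //; move: gt; rewrite -addnn; lia.
rewrite /zcos va; apply: th; lia.
Qed.

Lemma zcos_lt1 (a : Z) : a != 0 -> zcos a < 1.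
Proof.
move=> a0.
have Q0 : 0 < q.+2%:R :> R by rewrite ltr0n.
have a1 : (0 < a)%N by rewrite lt0n; apply: contraNneq a0 => e; apply/eqP/val_inj.
have pi0 := pi2_gt0.
pose lam : R := q.+2%:R^-1.
have lamQ : lam * q.+2%:R = 1 by rewrite mulVf // gt_eqF.
have lam0 : 0 < lam by rewrite invr_gt0.
have lam2 : lam <= 2^-1.
  by rewrite lef_pV2 ?posrE // ler_nat.
apply: le_lt_trans (zcos_le lam0 lam2 (L := 1) _ a1 _) _.
- by rewrite lamQ.
- by rewrite subn1 -ltnS ltn_ord.
rewrite -[X in _ < X](@cos0 R) ltr_cos ?pi2_itv ?lam2 ?ltW //.
  exact: mulr_gt0.
by rewrite in_itv /= lexx pi_ge0.
Qed.

End Characters.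

(** * Fourier analysis on [(Z/Q)^k] *)

Section Fourier.
Variables (R : realType) (q k : nat).
Notation T := 'cV['I_q.+2]_k.
Implicit Types (x y t d xi eta : T) (f g : T -> R) (P : {set T}).

Definition dot (xi x : T) : 'I_q.+2 := (xi^T *m x) 0 0.

Lemma dotC xi x : dot xi x = dot x xi.
Proof. by rewrite /dot -[in LHS](trmxK x) -trmx_mul mxE. Qed.

Lemma dotDr xi x y : dot xi (x + y) = dot xi x + dot xi y.
Proof. by rewrite /dot mulmxDr mxE. Qed.

Lemma dotNr xi x : dot xi (- x) = - dot xi x.
Proof. by rewrite /dot mulmxN mxE. Qed.

Lemma dot0r xi : dot xi 0 = 0.
Proof. by rewrite /dot mulmx0 mxE. Qed.

Lemma dot_delta xi i : dot xi (delta_mx i 0) = xi i 0.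
Proof. by rewrite /dot -colE !mxE. Qed.

Lemma dot_adj xi (M : 'M_k) x : dot xi (M *m x) = dot (M^T *m xi) x.
Proof. by rewrite /dot trmx_mul trmxK mulmxA. Qed.

Definition chcos xi x : R := zcos R (dot xi x).
Definition chsin xi x : R := zsin R (dot xi x).

Lemma chcosC xi x : chcos xi x = chcos x xi. Proof. by rewrite /chcos dotC. Qed.
Lemma chsinC xi x : chsin xi x = chsin x xi. Proof. by rewrite /chsin dotC. Qed.

Lemma chcosD xi x y :
  chcos xi (x + y) = chcos xi x * chcos xi y - chsin xi x * chsin xi y.
Proof. by rewrite /chcos dotDr zcosD. Qed.

Lemma chsinD xi x y :
  chsin xi (x + y) = chsin xi x * chcos xi y + chcos xi x * chsin xi y.
Proof. by rewrite /chsin dotDr zsinD. Qed.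

Lemma chcosN xi x : chcos xi (- x) = chcos xi x.
Proof. by rewrite /chcos dotNr zcosN. Qed.

Lemma chsinN xi x : chsin xi (- x) = - chsin xi x.
Proof. by rewrite /chsin dotNr zsinN. Qed.

Lemma chcosB xi x y :
  chcos xi (x - y) = chcos xi x * chcos xi y + chsin xi x * chsin xi y.
Proof. by rewrite chcosD chcosN chsinN mulrN opprK. Qed.

Lemma chcosBl xi eta x :
  chcos (xi - eta) x = chcos xi x * chcos eta x + chsin xi x * chsin eta x.
Proof. by rewrite chcosC chcosB -!(chcosC x) -!(chsinC x). Qed.

Lemma chcos_adj xi (M : 'M_k) x : chcos xi (M *m x) = chcos (M^T *m xi) x.
Proof. by rewrite /chcos dot_adj. Qed.

Lemma chcos_delta i x : chcos (delta_mx i 0) x = zcos R (x i 0).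
Proof. by rewrite /chcos dotC dot_delta. Qed.

Lemma chcos0 xi : chcos xi 0 = 1.
Proof. by rewrite /chcos dot0r zcos0. Qed.

Lemma chcos2Dchsin2 xi x : chcos xi x ^+ 2 + chsin xi x ^+ 2 = 1.
Proof. exact: zcos2Dzsin2. Qed.

Lemma chcos_le1 xi x : chcos xi x <= 1.
Proof. by have := chcos2Dchsin2 xi x; nra. Qed.

Lemma chcos_norm xi x : `|chcos xi x| <= 1.
Proof. by rewrite ler_norml; have := chcos2Dchsin2 xi x; nra. Qed.

Lemma chsin_norm xi x : `|chsin xi x| <= 1.
Proof. by rewrite ler_norml; have := chcos2Dchsin2 xi x; nra. Qed.

Lemma card_T_gt0 : (0 < #|{: T}|)%N.
Proof. by apply/card_gt0P; exists 0. Qed.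

Lemma avg_chsin xi : \E_x chsin xi x = 0 :> R.
Proof.
have : \E_x chsin xi x = - \E_x chsin xi x.
  rewrite {1}(reindex_avg _ (@oppr_inj T)) -avgN.
  by apply: eq_avg => x /=; exact: chsinN.
by lra.
Qed.

(** For [xi != 0], translation by a basis vector [x0] with [dot xi x0 != 0] multiplies the average
    by [chcos xi x0 < 1], since the sine average vanishes. *)
Lemma avg_chcos xi : \E_x chcos xi x = (xi == 0)%:R :> R.
Proof.
have [->|xi0] := eqVneq xi 0.
  rewrite (eq_avg (g := fun=> 1)) ?avg_cst ?card_T_gt0 // => x.
  by rewrite chcosC chcos0.
have [i xi_i] : exists i, xi i 0 != 0.
  by apply/cV0Pn.
pose x0 : T := delta_mx i 0.
have c1 : chcos xi x0 < 1 by rewrite /chcos dot_delta zcos_lt1.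
have : \E_x chcos xi x =
    (\E_x chcos xi x) * chcos xi x0 - (\E_x chsin xi x) * chsin xi x0.
  rewrite -!avgZr -avgB {1}(reindex_avg _ (addIr x0)).
  by apply: eq_avg => x /=; rewrite chcosD.
rewrite avg_chsin mulr0n => h.
have : (\E_x chcos xi x) * (1 - chcos xi x0) = 0 by lra.
by move/eqP; rewrite mulf_eq0 => /orP[/eqP//|]; rewrite subr_eq0 gt_eqF.
Qed.

(** Product-to-sum formula. Cosines do not separate [eta] from [- eta], hence the two terms. *)
Lemma avg_chcosM xi eta :
  \E_x (chcos xi x * chcos eta x) = 2^-1 * ((xi == eta)%:R + (xi == - eta)%:R) :> R.
Proof.
rewrite -(subr_eq0 xi) -(subr_eq0 xi (- _)) -!avg_chcos -avgD -avgZ.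
apply: eq_avg => x; rewrite !chcosBl (chcosC (- _)) (chsinC (- _)) chcosN chsinN.
by rewrite !(chcosC x) (chsinC x); lra.
Qed.

Lemma avg_delta f z : \E_y (f y * (#|{: T}|%:R * (y == z)%:R)) = f z.
Proof.
rewrite /avg (bigD1 z) //= eqxx mulr1 big1 ?addr0.
  rewrite mulrCA mulVf ?mulr1 // pnatr_eq0 -lt0n; exact: card_T_gt0.
by move=> y /negPf->; rewrite !mulr0.
Qed.

Lemma sum_chcosM x y :
  \sum_xi (chcos xi x * chcos xi y)
    = 2^-1 * (#|{: T}|%:R * (x == y)%:R + #|{: T}|%:R * (x == - y)%:R) :> R.
Proof.
have n0 : #|{: T}|%:R != 0 :> R by rewrite pnatr_eq0 -lt0n card_T_gt0.
rewrite -mulrDr mulrCA -avg_chcosM /avg mulVKf //.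
by apply: eq_bigr => xi _; rewrite -!(chcosC xi).
Qed.

Definition cos_coef f xi : R := \E_x (f x * chcos xi x).
Definition sin_coef f xi : R := \E_x (f x * chsin xi x).

(* The squared modulus of the Fourier coefficient of [f] at [xi]. *)
Definition power f xi : R := cos_coef f xi ^+ 2 + sin_coef f xi ^+ 2.

Lemma power_ge0 f xi : 0 <= power f xi.
Proof. by rewrite addr_ge0 ?sqr_ge0. Qed.

Lemma powerE f xi : power f xi = \E_x \E_y (f x * f y * chcos xi (x - y)).
Proof.
rewrite /power !expr2 -!avgZr -avgD; apply: eq_avg => x.
rewrite -!avgZ -avgD; apply: eq_avg => y.
by rewrite chcosB; ring.
Qed.

Lemma autocorrE f t : \E_x (f x * f (x + t)) = \sum_xi (power f xi * chcos xi t).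
Proof.
have h1 : \E_x (f x * f (x - t)) = \E_x (f x * f (x + t)).
  rewrite (reindex_avg _ (addIr t)); apply: eq_avg => x /=.
  by rewrite addrK mulrC.
transitivity (\E_x \E_y (f x * f y * \sum_xi (chcos xi (x - y) * chcos xi t))).
  transitivity (\E_x (2^-1 * (f x * f (x - t)) + 2^-1 * (f x * f (x + t)))).
    by rewrite avgD !avgZ h1; lra.
  apply: eq_avg => x.
  have -> : f x * f (x - t) = \E_y (f x * f y * (#|{: T}|%:R * (y == x - t)%:R)).
    by rewrite (avg_delta (fun y => f x * f y)).
  have -> : f x * f (x + t) = \E_y (f x * f y * (#|{: T}|%:R * (y == x + t)%:R)).
    by rewrite (avg_delta (fun y => f x * f y)).
  rewrite -!avgZ -avgD; apply: eq_avg => y; rewrite sum_chcosM.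
  have -> : (x - y == t) = (y == x - t).
    by rewrite subr_eq addrC -subr_eq eq_sym.
  have -> : (x - y == - t) = (y == x + t).
    by rewrite subr_eq addrC -subr_eq opprK eq_sym.
  by ring.
transitivity (\sum_xi \E_x \E_y (f x * f y * (chcos xi (x - y) * chcos xi t))).
  rewrite -avg_sum; apply: eq_avg => x; rewrite -avg_sum; apply: eq_avg => y.
  by rewrite mulr_sumr.
apply: eq_bigr => xi _; rewrite powerE -avgZr; apply: eq_avg => x.
by rewrite -avgZr; apply: eq_avg => y; rewrite mulrA.
Qed.

Lemma plancherel f : \E_x (f x ^+ 2) = \sum_xi power f xi.
Proof.
transitivity (\E_x (f x * f (x + 0))).
  by apply: eq_avg => x; rewrite addr0 expr2.
by rewrite autocorrE; apply: eq_bigr => xi _; rewrite chcos0 mulr1.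
Qed.

(** The multiplier is [|e(xi . t) - 1|^2 = 2 (1 - cos)]. *)
Lemma shift_norm2 f t :
  \E_x ((f (x + t) - f x) ^+ 2) = \sum_xi (power f xi * (2 * (1 - chcos xi t))).
Proof.
transitivity ((\E_x f x ^+ 2) * 2 - (\E_x f x * f (x + t)) * 2).
  have e : \E_x (f (x + t) ^+ 2) = \E_x (f x ^+ 2).
    by rewrite [RHS](reindex_avg _ (addIr t)).
  rewrite mulr_natr mulr2n -{1}e -avgD -avgZr -avgB.
  by apply: eq_avg => x; ring.
rewrite plancherel autocorrE -mulrBl -sumrB mulr_suml.
by apply: eq_bigr => xi _; ring.
Qed.

End Fourier.

Global Opaque avg chcos chsin.

(** * Folner kernels and smoothing *)

Section Kernel.
Variables (R : realType) (q k : nat).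
Notation T := 'cV['I_q.+2]_k.
Implicit Types (x y t d xi eta : T) (f g : T -> R) (P : {set T}).

(** This is the Fourier coefficient at [xi] of [kernel P] below. *)
Definition corr P xi : R :=
  #|P|%:R^-1 * #|[set x in P | (x + xi)%R \in P]|%:R.

Lemma corr_ge0 P xi : 0 <= corr P xi.
Proof. by rewrite mulr_ge0 ?invr_ge0. Qed.

Lemma corr_le1 P xi : corr P xi <= 1.
Proof.
have [P0|P0] := posnP #|P|.
  by rewrite /corr P0 invr0 mul0r.
rewrite /corr mulrC ler_pdivrMr ?ltr0n // mul1r ler_nat.
by apply/subset_leq_card/subsetP => x; rewrite inE => /andP[].
Qed.

Lemma corrN P xi : corr P (- xi) = corr P xi.
Proof.
rewrite /corr; congr (_ * _%:R); rewrite -(card_imset _ (addIr (- xi))).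
apply: eq_card => y; apply/imsetP/idP => [[x + ->]|]; rewrite !inE.
  by rewrite subrK => /andP[-> ->].
by case/andP=> yP yxP; exists (y + xi); rewrite ?inE ?addrK ?yxP.
Qed.

Definition diffset P : {set T} := [set xy.1 - xy.2 | xy in setX P P].

Lemma card_diffset P : (#|diffset P| <= #|P| ^ 2)%N.
Proof. by rewrite (leq_trans (leq_imset_card _ _)) // cardsX mulnn. Qed.

Lemma corr_eq0 P xi : xi \notin diffset P -> corr P xi = 0.
Proof.
move=> xiP; rewrite /corr (_ : [set _ in _ | _] = set0) ?cards0 ?mulr0 //.
apply/setP => x; rewrite !inE; apply: contraNF xiP => /andP[xP xxiP].
apply/imsetP; exists (x + xi, x); first by rewrite inE /= xP xxiP.
by rewrite /= addrAC subrr add0r.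
Qed.

(** The defect [1 - corr P xi] is the proportion of [P] that translation by [xi] moves out of [P],
    which is what the Folner property controls. *)
Lemma corr_ge (m : nat) P xi : (0 < #|P|)%N ->
  (#|[set x in P | (x + xi)%R \notin P]| * m.+1 <= #|P|)%N ->
  1 - corr P xi <= m.+1%:R^-1.
Proof.
move=> P0 h.
have e : #|P| = (#|[set x in P | (x + xi)%R \in P]|
                 + #|[set x in P | (x + xi)%R \notin P]|)%N.
  rewrite -(cardsID [set x | x + xi \in P] P); congr (_ + _)%N.
    by apply: eq_card => x; rewrite !inE.
  by apply: eq_card => x; rewrite !inE andbC.
have n0 : 0 < #|P|%:R :> R by rewrite ltr0n.
move: h; rewrite -(ler_nat R) natrM => h.
rewrite -[leRHS]mul1r ler_pdivlMr ?ltr0n //.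
have -> : 1 - corr P xi = #|P|%:R^-1 * #|[set x in P | (x + xi)%R \notin P]|%:R.
  rewrite /corr -{1}(mulVf (lt0r_neq0 n0)) -mulrBr; congr (_ * _).
  by rewrite {1}e natrD addrAC subrr add0r.
by rewrite -mulrA -(ler_pM2l n0) mulVKf ?mulr1 // gt_eqF.
Qed.

(** Each ordered pair of points of [P] has exactly one difference. *)
Lemma sum_corr P : (0 < #|P|)%N -> \sum_xi corr P xi = #|P|%:R.
Proof.
move=> P0; rewrite /corr -mulr_sumr.
have n0 : #|P|%:R != 0 :> R by rewrite pnatr_eq0 -lt0n.
suff -> : \sum_xi #|[set x in P | (x + xi)%R \in P]|%:R = #|P|%:R * #|P|%:R :> R.
  by rewrite mulKf.
under eq_bigr => xi _ do
  rewrite -sum1dep_card natr_sum big_mkcondr /=.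
rewrite exchange_big /= -natrM -sum_nat_const natr_sum.
apply: eq_bigr => x xP; rewrite -sum1_card natr_sum [RHS]big_mkcond.
by rewrite [RHS](reindex_inj (addrI x)); apply: eq_bigr => xi _; case: ifP.
Qed.

(** A Fejer-type kernel, written as a squared modulus to make its positivity immediate. *)
Definition kernel P d : R := #|P|%:R^-1 *
  ((\sum_(eta in P) chcos R eta d) ^+ 2 + (\sum_(eta in P) chsin R eta d) ^+ 2).

Lemma kernel_ge0 P d : 0 <= kernel P d.
Proof. by rewrite mulr_ge0 ?invr_ge0 ?addr_ge0 ?sqr_ge0. Qed.

(** Open the square and group the pairs of frequencies by their difference. *)
Lemma kernelE P d : kernel P d = \sum_xi (corr P xi * chcos R xi d).
Proof.
under eq_bigr do rewrite /corr -mulrA.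
rewrite -mulr_sumr /kernel; congr (_ * _).
transitivity (\sum_(eta in P) \sum_(eta' in P) chcos R (eta' - eta) d).
  rewrite !expr2 !big_distrlr -big_split /=; apply: eq_bigr => eta _.
  rewrite -big_split /=; apply: eq_bigr => eta' _.
  by rewrite chcosBl; ring.
under [RHS]eq_bigr => xi _ do
  rewrite -sum1dep_card natr_sum mulr_suml big_mkcondr /=.
rewrite [RHS]exchange_big /=; apply: eq_bigr => eta etaP.
rewrite [LHS]big_mkcond [LHS](reindex_inj (addrI eta)); apply: eq_bigr => xi _.
by rewrite addrAC subrr add0r; case: ifP => _; rewrite ?mul1r.
Qed.

Lemma kernelN P d : kernel P (- d) = kernel P d.
Proof. by rewrite !kernelE; apply: eq_bigr => xi _; rewrite chcosN. Qed.

Lemma kernel0 P : (0 < #|P|)%N -> kernel P 0 = #|P|%:R.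
Proof.
move=> P0; rewrite kernelE -sum_corr //; apply: eq_bigr => xi _.
by rewrite chcos0 mulr1.
Qed.

Lemma avg_kernel_chcos P xi : \E_d (kernel P d * chcos R xi d) = corr P xi.
Proof.
transitivity (\sum_eta corr P eta * (2^-1 * ((eta == xi)%:R + (eta == - xi)%:R))).
  transitivity (\sum_eta \E_d (corr P eta * (chcos R eta d * chcos R xi d))).
    rewrite -avg_sum; apply: eq_avg => d; rewrite kernelE mulr_suml.
    by apply: eq_bigr => eta _; rewrite mulrA.
  by apply: eq_bigr => eta _; rewrite avgZ avg_chcosM.
have pick z : \sum_eta corr P eta * (eta == z)%:R = corr P z.
  rewrite (bigD1 z) //= eqxx mulr1 big1 ?addr0 // => eta /negPf->.
  by rewrite mulr0.
under eq_bigr do rewrite mulrCA mulrDr.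
by rewrite -mulr_sumr big_split /= !pick corrN; lra.
Qed.

Lemma avg_kernel_chsin P xi : \E_d (kernel P d * chsin R xi d) = 0.
Proof.
have : \E_d (kernel P d * chsin R xi d) = - \E_d (kernel P d * chsin R xi d).
  rewrite {1}(reindex_avg _ (@oppr_inj T)) -avgN; apply: eq_avg => d /=.
  by rewrite kernelN chsinN mulrN.
by lra.
Qed.

Lemma corr0 P : (0 < #|P|)%N -> corr P 0 = 1.
Proof.
move=> P0; rewrite /corr (_ : [set _ in _ | _] = P) ?mulVf // ?pnatr_eq0 -?lt0n //.
by apply/setP => x; rewrite inE addr0 andbb.
Qed.

Lemma avg_kernel P : (0 < #|P|)%N -> \E_d kernel P d = 1.
Proof.
move=> P0; rewrite -(corr0 P0) -avg_kernel_chcos; apply: eq_avg => d.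
by rewrite chcosC chcos0 mulr1.
Qed.

Definition smooth P f x : R := \E_y (f y * kernel P (x - y)).

Lemma smoothE P f x : smooth P f x = \E_y (f y * kernel P (x - y)).
Proof. by []. Qed.

Lemma smooth_shift P f x : smooth P f x = \E_t (kernel P t * f (x - t)).
Proof.
have inj : injective (fun t => x - t) by move=> t t' /addrI/oppr_inj.
rewrite /smooth (reindex_avg _ inj); apply: eq_avg => t /=.
by rewrite subKr mulrC.
Qed.

Lemma smooth_itv P f x : (0 < #|P|)%N -> (forall y, 0 <= f y <= 1) ->
  0 <= smooth P f x <= 1.
Proof.
move=> P0 f01; rewrite smooth_shift -(avg_kernel P0) avg_ge0 => [|t]; last first.
  by rewrite mulr_ge0 ?kernel_ge0 //; case/andP: (f01 (x - t)).
apply: ler_avg => t; rewrite ler_piMr ?kernel_ge0 //.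
by case/andP: (f01 (x - t)).
Qed.

(** The convolution theorem; the sine coefficient of the kernel vanishes because the kernel is
    even. *)
Lemma cos_coef_smooth P f xi : cos_coef (smooth P f) xi = corr P xi * cos_coef f xi.
Proof.
transitivity (\E_x \E_y (f y * (kernel P (x - y) * chcos R xi x))).
  by apply: eq_avg => x; rewrite -avgZr; apply: eq_avg => y; rewrite mulrA.
rewrite avgC -avgZ; apply: eq_avg => y; rewrite avgZ [RHS]mulrCA; congr (_ * _).
rewrite (reindex_avg _ (addIr y)).
transitivity ((\E_t (kernel P t * chcos R xi t)) * chcos R xi y
              - (\E_t (kernel P t * chsin R xi t)) * chsin R xi y).
  rewrite -!avgZr -avgB; apply: eq_avg => t /=.
  by rewrite addrK chcosD; ring.
by rewrite avg_kernel_chcos avg_kernel_chsin mul0r subr0.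
Qed.

Lemma sin_coef_smooth P f xi : sin_coef (smooth P f) xi = corr P xi * sin_coef f xi.
Proof.
transitivity (\E_x \E_y (f y * (kernel P (x - y) * chsin R xi x))).
  by apply: eq_avg => x; rewrite -avgZr; apply: eq_avg => y; rewrite mulrA.
rewrite avgC -avgZ; apply: eq_avg => y; rewrite avgZ [RHS]mulrCA; congr (_ * _).
rewrite (reindex_avg _ (addIr y)).
transitivity ((\E_t (kernel P t * chsin R xi t)) * chcos R xi y
              + (\E_t (kernel P t * chcos R xi t)) * chsin R xi y).
  rewrite -!avgZr -avgD; apply: eq_avg => t /=.
  by rewrite addrK chsinD; ring.
by rewrite avg_kernel_chcos avg_kernel_chsin mul0r add0r.
Qed.

Lemma cos_coefB f g xi :
  cos_coef (fun x => f x - g x) xi = cos_coef f xi - cos_coef g xi.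
Proof. by rewrite -avgB; apply: eq_avg => x; rewrite mulrBl. Qed.

Lemma sin_coefB f g xi :
  sin_coef (fun x => f x - g x) xi = sin_coef f xi - sin_coef g xi.
Proof. by rewrite -avgB; apply: eq_avg => x; rewrite mulrBl. Qed.

Lemma power_smooth P f xi : power (smooth P f) xi = corr P xi ^+ 2 * power f xi.
Proof. by rewrite /power cos_coef_smooth sin_coef_smooth; ring. Qed.

Lemma power_sub_smooth P f xi :
  power (fun x => f x - smooth P f x) xi = (1 - corr P xi) ^+ 2 * power f xi.
Proof. by rewrite /power cos_coefB sin_coefB cos_coef_smooth sin_coef_smooth; ring. Qed.

Lemma power_smooth_sub P P' f xi :
  power (fun x => smooth P' f x - smooth P f x) xi
    = (corr P' xi - corr P xi) ^+ 2 * power f xi.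
Proof. by rewrite /power cos_coefB sin_coefB !cos_coef_smooth !sin_coef_smooth; ring. Qed.

End Kernel.

Global Opaque cos_coef sin_coef power kernel corr smooth.

(** * The counting lemma *)

Section Counting.
Variables (R : realType) (q k : nat).
Notation T := 'cV['I_q.+2]_k.
Notation mat := 'M['I_q.+2]_k.
Implicit Types (x y t d xi eta : T) (f g h : T -> R) (P W : {set T}) (M A B : mat).

Lemma unitmx_inj M : M \in unitmx -> injective (fun x => M *m x).
Proof. by move=> uM x y /(congr1 (mulmx (invmx M))); rewrite !mulKmx. Qed.

Lemma unitmxN M : (- M \in unitmx) = (M \in unitmx).
Proof. by rewrite -scaleN1r unitmxZ // unitrN unitr1. Qed.

Lemma norm_le_sqr (s z : R) : 0 < s -> `|z| <= 2^-1 * (s^-1 * z ^+ 2 + s).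
Proof.
move=> s0; rewrite -[z ^+ 2]real_normK ?num_real //; move: `|z| => a.
suff : 0 <= s^-1 * (a - s) ^+ 2.
  have -> : s^-1 * (a - s) ^+ 2 = s^-1 * a ^+ 2 + s - 2 * a.
    by field; rewrite gt_eqF.
  lra.
by rewrite mulr_ge0 ?sqr_ge0 // invr_ge0 ltW.
Qed.

(** Cauchy-Schwarz without square roots, from the pointwise AM-GM bound [norm_le_sqr]. *)
Lemma avg_norm_le s f : 0 < s -> \E_x (f x ^+ 2) <= s ^+ 2 -> \E_x `|f x| <= s.
Proof.
move=> s0 fs.
apply: le_trans (_ : \E_x (2^-1 * (s^-1 * f x ^+ 2 + s)) <= _).
  by apply: ler_avg => x; exact: norm_le_sqr.
rewrite avgZ avgD avgZ avg_cst ?card_T_gt0 //.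
have : s^-1 * (\E_x (f x ^+ 2)) <= s by rewrite ler_pdivrMl // -expr2.
by lra.
Qed.

Lemma norm_mul_le1 (a b : R) : `|b| <= 1 -> `|a * b| <= `|a|.
Proof. by move=> b1; rewrite normrM ler_piMr. Qed.

(* Cauchy-Schwarz in [v], then Fourier expansion of the correlations of [h]. *)
Lemma uniform_count A B (s : R) h f g : A \in unitmx -> B \in unitmx -> 0 < s ->
  (forall xi, power h xi <= s ^+ 2) ->
  (forall x, `|f x| <= 1) -> (forall x, `|g x| <= 1) ->
  `|\E_u \E_v (h (A *m u + B *m v) * f u * g v)| <= s.
Proof.
move=> uA uB s0 hs f1 g1; rewrite avgC.
pose X v := \E_u (h (A *m u + B *m v) * f u).
apply: le_trans (ler_norm_avg _) _.
apply: le_trans (_ : \E_v `|X v| <= _).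
  by apply: ler_avg => v; rewrite avgZr norm_mul_le1.
apply: avg_norm_le => //.
have f2 : \E_x (f x ^+ 2) <= 1.
  rewrite -[leRHS](avg_cst _ (card_T_gt0 q k)); apply: ler_avg => x.
  by rewrite -[f x ^+ 2]real_normK ?num_real // expr_le1.
(* Since [B] is invertible, averaging over [v] first leaves the autocorrelation of [h] at
   [A *m (u' - u)]; its Fourier expansion then produces the power of [f]. *)
have -> : \E_v (X v ^+ 2) = \sum_xi (power h xi * power f (A^T *m xi)).
  transitivity (\E_v \E_u \E_u'
    (f u * f u' * (h (A *m u + B *m v) * h (A *m u' + B *m v)))).
    apply: eq_avg => v; rewrite expr2 -avgZr; apply: eq_avg => u.
    by rewrite -avgZ; apply: eq_avg => u'; ring.
  rewrite avgC.
  transitivity (\E_u \E_u' (f u * f u' *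
      \sum_xi (power h xi * chcos R (A^T *m xi) (u - u')))).
    apply: eq_avg => u; rewrite avgC; apply: eq_avg => u'.
    rewrite avgZ; congr (_ * _).
    have -> : \sum_xi (power h xi * chcos R (A^T *m xi) (u - u'))
      = \sum_xi (power h xi * chcos R xi (A *m u' - A *m u)).
      apply: eq_bigr => xi _; rewrite -mulmxBr chcos_adj.
      by rewrite -(chcosN _ _ (u - u')) opprB.
    rewrite -autocorrE.
    have inj : injective (fun v : T => A *m u + B *m v).
      by move=> v v' /addrI; exact: unitmx_inj.
    rewrite [RHS](reindex_avg _ inj); apply: eq_avg => v /=.
    by congr (_ * h _); rewrite [RHS]addrC addrA subrK.
  transitivity (\sum_xi \E_u \E_u' (power h xi *
      (f u * f u' * chcos R (A^T *m xi) (u - u')))).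
    rewrite -avg_sum; apply: eq_avg => u; rewrite -avg_sum; apply: eq_avg => u'.
    by rewrite mulr_sumr; apply: eq_bigr => xi _; rewrite mulrCA.
  apply: eq_bigr => xi _; rewrite [power f _]powerE -avgZ; apply: eq_avg => u.
  by rewrite avgZ.
apply: le_trans (_ : s ^+ 2 * (\E_x (f x ^+ 2)) <= _); last first.
  by rewrite ler_piMr ?sqr_ge0.
rewrite plancherel [in leRHS](reindex_inj (@unitmx_inj A^T _)) ?unitmx_tr //.
by rewrite mulr_sumr ler_sum // => xi _; rewrite ler_wpM2r ?power_ge0.
Qed.

Definition form W A B h f g : R :=
  \E_y \E_d (kernel R W d * (h y * f (y + A *m d) * g (y + B *m d))).

Lemma formE W A B h f g : form W A B h f g =
  \E_y \E_d (kernel R W d * (h y * f (y + A *m d) * g (y + B *m d))).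
Proof. by []. Qed.

(** In the variables [u = y + A d] and [v = y + B d] one has [d = D (v - u)] and [y = U u + V v],
    with all three matrices invertible. Expanding the kernel in characters reduces to
    [uniform_count]; its coefficients sum to [#|W|], and each costs a cosine and a sine term. *)
Lemma form_uniform W A B (s : R) h f g : (0 < #|W|)%N ->
  A \in unitmx -> B \in unitmx -> A - B \in unitmx -> 0 < s ->
  (forall xi, power h xi <= s ^+ 2) ->
  (forall x, `|f x| <= 1) -> (forall x, `|g x| <= 1) ->
  `|form W A B h f g| <= 2 * #|W|%:R * s.
Proof.
move=> W0 uA uB uAB s0 hs f1 g1.
have uBA := uAB; rewrite -opprB unitmxN in uBA.
pose D := invmx (B - A).
have uD : D \in unitmx by rewrite unitmx_inv.
pose U := B *m D; pose V := - (A *m D).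
have uU : U \in unitmx by rewrite unitmx_mul uB.
have uV : V \in unitmx by rewrite unitmxN unitmx_mul uA.
have eU : U = 1%:M + A *m D.
  by rewrite -(mulmxV uBA) -mulmxDl subrK.
have -> : form W A B h f g = \E_u \E_v
    (kernel R W (D *m (v - u)) * (h (U *m u + V *m v) * f u * g v)).
  rewrite /form avgC.
  transitivity (\E_d \E_u (kernel R W d *
      (h (u - A *m d) * f u * g (u + (B - A) *m d)))).
    apply: eq_avg => d; rewrite [RHS](reindex_avg _ (addIr (A *m d))).
    apply: eq_avg => y /=; rewrite addrK mulmxBl.
    by rewrite addrACA subrr addr0.
  rewrite avgC; apply: eq_avg => u.
  have inj : injective (fun v : T => D *m (v - u)).
    by move=> v v' /(unitmx_inj uD)/addIr.
  rewrite (reindex_avg _ inj); apply: eq_avg => v /=.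
  have -> : (B - A) *m (D *m (v - u)) = v - u by exact: (mulKVmx uBA).
  rewrite (addrC u (v - u)) subrK.
  congr (_ * (h _ * _ * _)).
  by rewrite eU /V mulmxDl mul1mx mulNmx -!mulmxA !mulmxBr opprB addrA.
(* A character of [D *m (v - u)] splits into factors in [u] and in [v], which are absorbed into the
   bounded functions [f] and [g]. *)
pose E (f' g' : T -> R) := \E_u \E_v (h (U *m u + V *m v) * f' u * g' v) : R.
pose mc xi f' x := f' x * chcos R (D^T *m xi) x : R.
pose ms xi f' x := f' x * chsin R (D^T *m xi) x : R.
have -> : \E_u \E_v
    (kernel R W (D *m (v - u)) * (h (U *m u + V *m v) * f u * g v))
    = \sum_xi (corr R W xi * (E (mc xi f) (mc xi g) + E (ms xi f) (ms xi g))).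
  transitivity (\sum_xi \E_u \E_v (corr R W xi * chcos R xi (D *m (v - u)) *
      (h (U *m u + V *m v) * f u * g v))).
    rewrite -avg_sum; apply: eq_avg => u; rewrite -avg_sum; apply: eq_avg => v.
    by rewrite kernelE mulr_suml.
  apply: eq_bigr => xi _; rewrite -avgD -avgZ; apply: eq_avg => u.
  rewrite -avgD -avgZ; apply: eq_avg => v.
  by rewrite chcos_adj chcosB /mc /ms; ring.
apply: le_trans (ler_norm_sum _ _ _) _.
rewrite -sum_corr // mulrAC mulr_sumr ler_sum // => xi _.
rewrite normrM ger0_norm ?corr_ge0 // mulrC ler_wpM2r ?corr_ge0 //.
apply: le_trans (ler_normD _ _) _.
have m1 (a b : R) : `|a| <= 1 -> `|b| <= 1 -> `|a * b| <= 1.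
  by move=> a1 b1; rewrite normrM mulr_ile1.
have e1 : `|E (mc xi f) (mc xi g)| <= s.
  by apply: (uniform_count uU uV s0 hs) => x; rewrite m1 // chcos_norm.
have e2 : `|E (ms xi f) (ms xi g)| <= s.
  by apply: (uniform_count uU uV s0 hs) => x; rewrite m1 // chsin_norm.
lra.
Qed.

Lemma form_L1 W A B h f g : (0 < #|W|)%N ->
  (forall x, `|f x| <= 1) -> (forall x, `|g x| <= 1) ->
  `|form W A B h f g| <= \E_x `|h x|.
Proof.
move=> W0 f1 g1; apply: le_trans (ler_norm_avg _) _; apply: ler_avg => y.
apply: le_trans (ler_norm_avg _) _.
rewrite -[leRHS]mul1r -(avg_kernel R W0) -avgZr; apply: ler_avg => d.
rewrite normrM ger0_norm ?kernel_ge0 // ler_wpM2l ?kernel_ge0 //.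
by rewrite -mulrA norm_mul_le1 // normrM mulr_ile1.
Qed.

Lemma formB W A B h h' f g :
  form W A B (fun x => h x - h' x) f g = form W A B h f g - form W A B h' f g.
Proof.
rewrite /form -avgB; apply: eq_avg => y; rewrite -avgB; apply: eq_avg => d.
by ring.
Qed.

Lemma form_swap W A B h f g : form W A B h f g = form W B A h g f.
Proof. by apply: eq_avg => y; apply: eq_avg => d; ring. Qed.

(** Moves the base point of the pattern to [y + A d]. With [form_swap] it brings any of the three
    functions to the first slot. *)
Lemma form_rot W A B h f g : form W A B h f g = form W (- A) (B - A) f h g.
Proof.
rewrite /form avgC [RHS]avgC; apply: eq_avg => d.
rewrite [RHS](reindex_avg _ (addIr (A *m d))); apply: eq_avg => y /=.
rewrite mulNmx addrK mulmxBl addrACA subrr addr0; ring.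
Qed.

End Counting.

Global Opaque form.

(** * Regularity by energy increment *)

Section Structured.
Variables (R : realType) (q k : nat).
Notation T := 'cV['I_q.+2]_k.
Notation mat := 'M['I_q.+2]_k.
Implicit Types (x y t d xi eta : T) (P W : {set T}) (M A B : mat).
Variable f : T -> R.
Hypothesis f01 : forall x, 0 <= f x <= 1.

Let f_norm x : `|f x| <= 1.
Proof. by have /andP[f0 f1] := f01 x; rewrite ger0_norm. Qed.

Let p P := smooth P f.

Let p01 P x : (0 < #|P|)%N -> 0 <= p P x <= 1.
Proof. by move=> P0; exact: smooth_itv. Qed.

Let p_norm P x : (0 < #|P|)%N -> `|p P x| <= 1.
Proof. by move=> P0; have /andP[p0 p1] := p01 x P0; rewrite ger0_norm. Qed.

Lemma sum_power_le1 : \sum_xi power f xi <= 1.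
Proof.
rewrite -plancherel -[leRHS](avg_cst _ (card_T_gt0 q k)); apply: ler_avg => x.
by have := f01 x; nra.
Qed.

Lemma power_le1 xi : power f xi <= 1.
Proof.
apply: le_trans sum_power_le1; rewrite (bigD1 xi) //= lerDl sumr_ge0 // => eta _.
exact: power_ge0.
Qed.

(** Averaging [shift_norm2] against the kernel turns each cosine into [corr W (M^T xi)], and only
    [xi] in [diffset P] occur in the spectrum of [p P]. *)
Lemma shift_small P W M (e : R) : (0 < #|W|)%N -> 0 <= e ->
  (forall xi, xi \in diffset P -> 1 - corr R W (M^T *m xi) <= e) ->
  \E_d (kernel R W d * \E_x ((p P (x + M *m d) - p P x) ^+ 2)) <= 2 * e.
Proof.
move=> W0 e0 hW.
have -> : \E_d (kernel R W d * \E_x ((p P (x + M *m d) - p P x) ^+ 2))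
  = \sum_xi (power (p P) xi * (2 * (1 - corr R W (M^T *m xi)))).
  transitivity (\sum_xi \E_d (power (p P) xi * (2 * (kernel R W d
      - kernel R W d * chcos R (M^T *m xi) d)))).
    rewrite -avg_sum; apply: eq_avg => d; rewrite shift_norm2 mulr_sumr.
    by apply: eq_bigr => xi _; rewrite chcos_adj; ring.
  by apply: eq_bigr => xi _; rewrite !avgZ avgB avg_kernel // avg_kernel_chcos.
apply: le_trans (_ : \sum_xi (power f xi * (2 * e)) <= _); last first.
  by rewrite -mulr_suml ler_piMl ?sum_power_le1 ?mulr_ge0.
apply: ler_sum => xi _; rewrite /p power_smooth.
have [xiP|xiP] := boolP (xi \in diffset P); last first.
  by rewrite corr_eq0 // expr0n /= !mul0r mulr_ge0 ?power_ge0 ?mulr_ge0.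
have c0 := corr_ge0 R P xi; have c1 := corr_le1 R P xi.
have w1 := corr_le1 R W (M^T *m xi).
apply: ler_pM.
- exact: mulr_ge0 (sqr_ge0 _) (power_ge0 _ _).
- by rewrite mulr_ge0 ?subr_ge0.
- by rewrite ler_piMl ?power_ge0 // expr_le1.
- by rewrite ler_wpM2l // hW.
Qed.

Lemma shift_small_L1 P W M (s : R) : (0 < #|W|)%N -> 0 < s ->
  (forall xi, xi \in diffset P -> 1 - corr R W (M^T *m xi) <= s ^+ 2 / 2) ->
  \E_x \E_d (kernel R W d * `|p P (x + M *m d) - p P x|) <= s.
Proof.
move=> W0 s0 hW; rewrite avgC.
have s2 : 0 <= s ^+ 2 / 2 by rewrite divr_ge0 ?sqr_ge0.
have h := shift_small W0 s2 hW.
apply: le_trans (_ : \E_d (2^-1 * (s^-1 * (kernel R W d *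
   \E_x ((p P (x + M *m d) - p P x) ^+ 2)) + s * kernel R W d)) <= _).
  apply: ler_avg => d; rewrite avgZ.
  have -> : forall z : R, 2^-1 * (s^-1 * (kernel R W d * z) + s * kernel R W d)
    = kernel R W d * (2^-1 * (s^-1 * z + s)) by move=> z; ring.
  rewrite ler_wpM2l ?kernel_ge0 //.
  apply: le_trans (_ : \E_x (2^-1 * (s^-1 *
     (p P (x + M *m d) - p P x) ^+ 2 + s)) <= _).
    by apply: ler_avg => x; exact: norm_le_sqr.
  by rewrite avgZ avgD avgZ avg_cst ?card_T_gt0.
rewrite avgZ avgD 2!avgZ avg_kernel // mulr1.
have : s^-1 * (2 * (s ^+ 2 / 2)) = s by field; rewrite gt_eqF.
have : s^-1 * (\E_d (kernel R W d * \E_x ((p P (x + M *m d) - p P x) ^+ 2)))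
   <= s^-1 * (2 * (s ^+ 2 / 2)) by rewrite ler_wpM2l // invr_ge0 ltW.
lra.
Qed.

(** Telescoping [a b c - a^3 = a (b - a) c + a a (c - a)] with values in [[0, 1]]: each of the two
    shifts costs at most [s]. *)
Lemma form_structured P W A B (s : R) :
  (0 < #|P|)%N -> (0 < #|W|)%N -> 0 < s ->
  (forall xi, xi \in diffset P -> 1 - corr R W (A^T *m xi) <= s ^+ 2 / 2) ->
  (forall xi, xi \in diffset P -> 1 - corr R W (B^T *m xi) <= s ^+ 2 / 2) ->
  \E_x (p P x ^+ 3) - 2 * s <= form W A B (p P) (p P) (p P).
Proof.
move=> P0 W0 s0 hA hB.
have aux (a b c : R) : b <= s -> c <= s -> a - 2 * s <= a - b - c.
  by move=> *; lra.
have kA := shift_small_L1 W0 s0 hA; have kB := shift_small_L1 W0 s0 hB.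
apply: le_trans (_ : \E_x (p P x ^+ 3)
   - (\E_x \E_d (kernel R W d * `|p P (x + A *m d) - p P x|))
   - (\E_x \E_d (kernel R W d * `|p P (x + B *m d) - p P x|)) <= _).
  exact: aux kA kB.
rewrite -!avgB; apply: ler_avg => x.
rewrite -[p P x ^+ 3]mul1r -(avg_kernel R W0) -avgZr -!avgB; apply: ler_avg => d.
rewrite -2!mulrBr ler_wpM2l ?kernel_ge0 //.
have := p01 x P0; have := p01 (x + A *m d) P0; have := p01 (x + B *m d) P0.
clear kA kB hA hB; move: (p P x) (p P (x + A *m d)) (p P (x + B *m d)) => a b c.
move=> /andP[c0 c1] /andP[b0 b1] /andP[a0 a1].
have h1 : `|a * (b - a) * c| <= `|b - a|.
  by rewrite mulrAC mulrC norm_mul_le1 // ger0_norm ?mulr_ge0 // mulr_ile1.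
have h2 : `|a * a * (c - a)| <= `|c - a|.
  by rewrite mulrC norm_mul_le1 // ger0_norm ?mulr_ge0 // mulr_ile1.
have e : a * b * c - a ^+ 3 = a * (b - a) * c + a * a * (c - a) by ring.
move: h1 h2; rewrite !ler_norml => /andP[h1 _] /andP[h2 _].
by lra.
Qed.

(** Passing from [f] to [p P1] is paid by uniformity, and from [p P1] to [p P] by smallness in
    L^2. *)
Lemma form_sub P P1 W A B (s r : R) g h : (0 < #|W|)%N ->
  A \in unitmx -> B \in unitmx -> A - B \in unitmx -> 0 < s -> 0 < r ->
  \E_x ((p P1 x - p P x) ^+ 2) <= s ^+ 2 ->
  (forall xi, power (fun x => f x - p P1 x) xi <= r ^+ 2) ->
  2 * #|W|%:R * r <= s ->
  (forall x, `|g x| <= 1) -> (forall x, `|h x| <= 1) ->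
  `|form W A B f g h - form W A B (p P) g h| <= 2 * s.
Proof.
move=> W0 uA uB uAB s0 r0 hP hr Wr g1 h1.
have e1 : `|form W A B f g h - form W A B (p P1) g h| <= s.
  by rewrite -formB; apply: le_trans (form_uniform W0 uA uB uAB r0 hr g1 h1) Wr.
have e2 : `|form W A B (p P1) g h - form W A B (p P) g h| <= s.
  rewrite -formB; apply: le_trans (form_L1 _ _ _ W0 g1 h1) _.
  exact: avg_norm_le.
move: e1 e2; rewrite !ler_norml => /andP[? ?] /andP[? ?]; apply/andP; lra.
Qed.

(** [f] is replaced by [p P] in one slot after the other, each rotated to the front. This costs
    three times [2 * s], and [form_structured] costs another [2 * s]. *)
Lemma form_lower P P1 W A B (s r : R) :
  (0 < #|P|)%N -> (0 < #|W|)%N ->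
  A \in unitmx -> B \in unitmx -> A - B \in unitmx -> 0 < s -> 0 < r ->
  (forall xi, xi \in diffset P -> 1 - corr R W (A^T *m xi) <= s ^+ 2 / 2) ->
  (forall xi, xi \in diffset P -> 1 - corr R W (B^T *m xi) <= s ^+ 2 / 2) ->
  \E_x ((p P1 x - p P x) ^+ 2) <= s ^+ 2 ->
  (forall xi, power (fun x => f x - p P1 x) xi <= r ^+ 2) ->
  2 * #|W|%:R * r <= s ->
  \E_x (p P x ^+ 3) - 8 * s <= form W A B f f f.
Proof.
move=> P0 W0 uA uB uAB s0 r0 hA hB hP hr Wr.
have uNA : - A \in unitmx by rewrite unitmxN.
have uNB : - B \in unitmx by rewrite unitmxN.
have uBA := uAB; rewrite -opprB unitmxN in uBA.
have h1 := form_structured P0 W0 s0 hA hB.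
have pn x := p_norm x P0.
have := form_sub W0 uA uB uAB s0 r0 hP hr Wr f_norm f_norm.
have uA' : - A - (B - A) \in unitmx by rewrite opprB addKr; exact: uNB.
have := form_sub W0 uNA uBA uA' s0 r0 hP hr Wr pn f_norm.
have uB' : - B - (A - B) \in unitmx by rewrite opprB addKr; exact: uNA.
have := form_sub W0 uNB uAB uB' s0 r0 hP hr Wr pn pn.
rewrite -!form_rot (form_swap _ B A) (form_swap _ B A (p P) (p P)).
rewrite !ler_norml => /andP[? ?] /andP[? ?] /andP[? ?]; lra.
Qed.

(** By Plancherel, the squared L^2 norm of [smooth P f]. *)
Definition energy P : R := \sum_xi (corr R P xi ^+ 2 * power f xi).

Lemma energy_le1 P : energy P <= 1.
Proof.
apply: le_trans sum_power_le1; apply: ler_sum => xi _.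
rewrite ler_piMl ?power_ge0 // expr_le1 ?corr_le1 // corr_ge0 //.
Qed.

(** Frequency by frequency, with [a = corr P] and [b = corr P1]:
    [(b - a)^2 = b^2 - a^2 + 2 a (a - b)], where [a = 0] off [diffset P] and [a - b <= e] on it. *)
Lemma energy_increment P P1 (e : R) : 0 <= e ->
  (forall xi, xi \in diffset P -> 1 - corr R P1 xi <= e) ->
  \E_x ((p P1 x - p P x) ^+ 2) <= energy P1 - energy P + 2 * e.
Proof.
move=> e0 h; rewrite (plancherel (fun x => p P1 x - p P x)).
apply: le_trans (_ : energy P1 - energy P + (\sum_xi power f xi) * (2 * e) <= _);
  last by rewrite lerD2l ler_piMl ?sum_power_le1 ?mulr_ge0.
rewrite /energy -sumrB mulr_suml -big_split; apply: ler_sum => xi _ /=.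
rewrite power_smooth_sub -mulrBl [power f xi * _]mulrC -mulrDl ler_wpM2r ?power_ge0 //.
have c0 := corr_ge0 R P xi; have c1 := corr_le1 R P xi.
have [xiP|xiP] := boolP (xi \in diffset P); last first.
  by rewrite (corr_eq0 _ xiP); nra.
have := h _ xiP; have := corr_le1 R P1 xi; nra.
Qed.

(** Chebyshev's inequality, the powers having sum at most 1. *)
Lemma card_spectrum (t : nat) :
  (#|[set xi | (t.+1%:R^-1 ^+ 2 < power f xi)%R]| <= t.+1 ^ 2)%N.
Proof.
have t0 : 0 < t.+1%:R :> R by rewrite ltr0n.
rewrite -(ler_nat R) natrX -[leRHS]mul1r -ler_pdivrMr ?exprn_gt0 // -exprVn.
apply: le_trans sum_power_le1.
rewrite -sum1_card natr_sum mulr_suml.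
rewrite [leRHS](bigID (mem [set xi | t.+1%:R^-1 ^+ 2 < power f xi])) /=.
rewrite -[leLHS]addr0 lerD ?sumr_ge0 // => [|xi _]; last exact: power_ge0.
by apply: ler_sum => xi; rewrite inE mul1r => /ltW.
Qed.

End Structured.

Lemma card_setU_le (T : finType) (A B : {set T}) (a b : nat) :
  (#|A| <= a)%N -> (#|B| <= b)%N -> (#|A :|: B| <= a + b)%N.
Proof. by move=> Aa Bb; rewrite (leq_trans (leq_card_setU _ _)) ?leq_add. Qed.

Section Regularity.
Variables (R : realType) (k : nat).
Notation vec q := ('cV['I_q.+2]_k).

Definition adapted (q m : nat) (S P : {set vec q}) :=
  forall xi, xi \in S -> 1 - corr R P xi <= m.+1%:R^-1.

Lemma exists_adapted (n m : nat) : exists C : nat,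
  forall (q : nat) (S : {set vec q}), (#|S| <= n)%N ->
  exists P : {set vec q}, [/\ (0 < #|P|)%N, (#|P| <= C)%N & adapted m S P].
Proof.
have [C hC] := folner n m.+1; exists C => q S /hC[P [P0 PC hP]].
by exists P; split=> // xi /hP; exact: corr_ge.
Qed.

Lemma exists_inv_le (e : R) : 0 < e -> exists t : nat, t.+1%:R^-1 <= e.
Proof.
move=> e0; exists (Num.truncn e^-1).
rewrite -[leRHS]invrK lef_pV2 ?posrE ?ltr0n ?invr_gt0 //.
by rewrite ltW // truncnS_gt // invr_ge0 ltW.
Qed.

(** [P] is the smoothing set and [W] the set whose kernel weights [d]. The bound on [W] later makes
    the contribution of [d = 0] negligible. *)
Definition well_approximated (m C : nat) (s : R) (q : nat)
    (A B : 'M['I_q.+2]_k) (f : vec q -> R) (S : {set vec q}) :=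
  exists P W : {set vec q}, [/\ (0 < #|P|)%N, (0 < #|W|)%N, (#|W| <= C)%N,
    adapted m S P /\ adapted m S W &
    \E_x (smooth P f x ^+ 3) - 8 * s <= form W A B f f f].

(* If [P] does not work, then adding its difference set and the large spectrum
   of [f] to the frequencies raises the energy by at least [s ^ 2 / 2]. *)
Lemma energy_step (n m : nat) (s : R) (J : nat) : 0 < s ->
  m.+1%:R^-1 <= s ^+ 2 / 4 ->
  exists C : nat, forall (q : nat) (A B : 'M['I_q.+2]_k) (f : vec q -> R)
    (S : {set vec q}),
    A \in unitmx -> B \in unitmx -> A - B \in unitmx ->
    (forall x, 0 <= f x <= 1) -> (#|S| <= n)%N ->
    well_approximated m C s A B f S \/
    exists P : {set vec q}, [/\ (0 < #|P|)%N, (#|P| <= C)%N, adapted m S P &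
      J%:R * (s ^+ 2 / 2) <= energy f P].
Proof.
move=> s0 hm; elim: J => [|J [C IH]].
  have [C hC] := exists_adapted n m; exists C => q A B f S uA uB uAB f01 Sn.
  right; have [P [P0 PC hP]] := hC _ _ Sn; exists P; split=> //.
  by rewrite mul0r sumr_ge0 // => xi _; exact: mulr_ge0 (sqr_ge0 _) (power_ge0 _ _).
(* Room for [S] and the images of [diffset P] under [A^T] and [B^T]. As [CW] depends only on the
   bound [C] for [P], the uniformity threshold [t] can be fixed next, so that
   [2 * #|W| / (t + 1) <= s]. *)
have [CW hW] := exists_adapted (n + C ^ 2 + C ^ 2) m.
have [t ht] : exists t : nat, t.+1%:R^-1 <= s / (2 * CW.+1%:R) :> R.
  by apply: exists_inv_le; rewrite divr_gt0 // mulr_gt0 // ltr0n.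
have [C1 hC1] := exists_adapted (n + C ^ 2 + t.+1 ^ 2) (maxn m t).
exists (maxn C (maxn CW C1)) => q A B f S uA uB uAB f01 Sn.
have [[P [W [P0 W0 WC PW hf]]]|[P [P0 PC hP eP]]] := IH q A B f S uA uB uAB f01 Sn.
  by left; exists P, W; split=> //; rewrite (leq_trans WC) ?leq_maxl.
have DC : (#|diffset P| <= C ^ 2)%N.
  by rewrite (leq_trans (card_diffset P)) // leq_exp2r.
have DM (M : 'M['I_q.+2]_k) : (#|[set M^T *m xi | xi in diffset P]| <= C ^ 2)%N.
  exact: leq_trans (leq_imset_card _ _) DC.
have [W [W0 WC hWS]] := hW q _ (card_setU_le (card_setU_le Sn (DM A)) (DM B)).
have [P1 [P10 P1C hP1]] :=
  hC1 q _ (card_setU_le (card_setU_le Sn DC) (card_spectrum f01 t)).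
have maxm : (maxn m t).+1%:R^-1 <= m.+1%:R^-1 :> R.
  by rewrite lef_pV2 ?posrE ?ltr0n // ler_nat ltnS leq_maxl.
have maxt : (maxn m t).+1%:R^-1 <= t.+1%:R^-1 :> R.
  by rewrite lef_pV2 ?posrE ?ltr0n // ler_nat ltnS leq_maxr.
have P1S : adapted m S P1.
  by move=> xi xiS; apply: le_trans maxm; apply: hP1; rewrite !inE xiS.
have m0 : 0 <= m.+1%:R^-1 :> R by rewrite invr_ge0.
have inc : \E_x ((smooth P1 f x - smooth P f x) ^+ 2)
    <= energy f P1 - energy f P + 2 * m.+1%:R^-1.
  apply: energy_increment => // xi xiD; apply: le_trans maxm.
  by apply: hP1; rewrite !inE xiD orbT.
(* A gain above [s^2 / 2] continues the iteration. Otherwise [inc] and [2 / (m + 1) <= s^2 / 2]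
   bound the L^2 distance by [s]. *)
have [small|big] := leP (energy f P1 - energy f P) (s ^+ 2 / 2); last first.
  right; exists P1; split=> //.
    by rewrite (leq_trans P1C) // !leq_max leqnn !orbT.
  rewrite -natr1 mulrDl mul1r.
  move: eP big; move: (energy f P1) (energy f P) (J%:R * _) => a b c; lra.
left; exists P, W; split=> //.
- by rewrite (leq_trans WC) // !leq_max leqnn !orbT.
- by split=> // xi xiS; apply: hWS; rewrite !inE xiS.
have r0 : 0 < t.+1%:R^-1 :> R by rewrite invr_gt0 ltr0n.
have s2 : m.+1%:R^-1 <= s ^+ 2 / 2.
  by apply: le_trans hm _; have := sqr_ge0 s; move: (s ^+ 2) => s2; lra.
apply: (form_lower (P1 := P1) f01 P0 W0 uA uB uAB s0 r0).
- move=> xi xiD; apply: le_trans s2; apply: hWS.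
  by rewrite !inE imset_f ?orbT.
- move=> xi xiD; apply: le_trans s2; apply: hWS.
  by rewrite !inE imset_f ?orbT.
- apply: le_trans inc _; move: small hm.
  by move: (energy f P1) (energy f P) (m.+1%:R^-1) (s ^+ 2) => a b c d; lra.
- move=> xi; rewrite power_sub_smooth.
  have c0 : 0 <= 1 - corr R P1 xi by rewrite subr_ge0 corr_le1.
  have p1 := power_le1 f01 xi; have p0 := power_ge0 f xi.
  (* On the large spectrum [P1] is adapted, so the factor [1 - corr] is small; elsewhere the power
     of [f] itself is. *)
  have [xiL|xiL] := ltP (t.+1%:R^-1 ^+ 2) (power f xi).
    apply: le_trans (ler_piMr _ p1) _; first exact: sqr_ge0.
    rewrite ler_sqr ?nnegrE ?(ltW r0) //; apply: le_trans maxt; apply: hP1.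
    by rewrite !inE xiL !orbT.
  apply: le_trans xiL; rewrite ler_piMl // expr_le1 //.
  by rewrite lerBlDr lerDl corr_ge0.
have Wle : #|W|%:R <= CW.+1%:R :> R by rewrite ler_nat ltnW.
have W1 : 0 < CW.+1%:R :> R by rewrite ltr0n.
apply: le_trans (_ : 2 * CW.+1%:R * (s / (2 * CW.+1%:R)) <= _).
  by apply: ler_pM => //; rewrite ?mulr_ge0 ?ler_wpM2l // ltW.
by rewrite mulrC divfK // mulf_neq0 // gt_eqF.
Qed.

(** After more than [2 / s^2] increments the energy would exceed 1, so only the first alternative of
    [energy_step] remains. *)
Lemma regularity (n m : nat) (s : R) : 0 < s -> m.+1%:R^-1 <= s ^+ 2 / 4 ->
  exists C : nat, forall (q : nat) (A B : 'M['I_q.+2]_k) (f : vec q -> R)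
    (S : {set vec q}),
    A \in unitmx -> B \in unitmx -> A - B \in unitmx ->
    (forall x, 0 <= f x <= 1) -> (#|S| <= n)%N ->
    well_approximated m C s A B f S.
Proof.
move=> s0 hm; have e0 : 0 < s ^+ 2 / 2 by rewrite divr_gt0 ?exprn_gt0.
have [J hJ] := exists_inv_le e0.
have [C hC] := energy_step n J.+2 s0 hm; exists C => q A B f S uA uB uAB f01 Sn.
have [//|[P [_ _ _]]] := hC q A B f S uA uB uAB f01 Sn.
have := energy_le1 f01 P.
have J0 : 0 < J.+1%:R :> R by rewrite ltr0n.
have : 1 <= J.+1%:R * (s ^+ 2 / 2).
  by rewrite -[leLHS](mulfV (lt0r_neq0 J0)) ler_wpM2l // ltW.
rewrite -[J.+2%:R]natr1 mulrDl mul1r.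
by move: (energy f P) (s ^+ 2 / 2) e0 (J.+1%:R * _) => a b b0 c; lra.
Qed.

End Regularity.

(** * Localisation to the cube *)

Section Localisation.
Variables (R : realType) (q k : nat).
Notation T := 'cV['I_q.+2]_k.
Implicit Types (x y t d xi : T) (P W : {set T}).

(* Every coordinate has a representative in [(- L, L)]. *)
Definition near0 (L : nat) d :=
  [forall i, (d i 0%R < L)%N || (q.+2 - L < d i 0%R)%N].

Definition basis : {set T} := [set delta_mx i 0 | i : 'I_k].

Lemma card_basis : (#|basis| <= k)%N.
Proof. by rewrite (leq_trans (leq_imset_card _ _)) // card_ord. Qed.

Section Far.
Variables (m L : nat) (lam : R) (P : {set T}).
Hypotheses (lam0 : 0 < lam) (lam2 : lam <= 2^-1).
Hypothesis lamL : lam * q.+2%:R <= L%:R.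
Hypotheses (P0 : (0 < #|P|)%N) (hP : adapted R m basis P).

Definition kappa : R := 1 - cos (pi *+ 2 * lam).

Lemma kappa_gt0 : 0 < kappa.
Proof.
rewrite subr_gt0 -[ltRHS](@cos0 R) ltr_cos ?pi2_itv ?lam2 ?ltW //.
  by rewrite mulr_gt0 ?pi2_gt0.
by rewrite in_itv /= lexx pi_ge0.
Qed.

Definition far_bound : R := k%:R * m.+1%:R^-1 / kappa.

(** Markov's inequality: a far [d] has a coordinate [i] where [1 - chcos] of the basis frequency is
    at least [kappa], while its mean against the kernel is [1 - corr]. The factor [k] is a union
    bound. *)
Lemma far_weight : \E_d (kernel R P d * (~~ near0 L d)%:R) <= far_bound.
Proof.
have k0 := kappa_gt0.
apply: le_trans (_ : \E_d \sum_(i < k) (kappa^-1 *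
    (kernel R P d - kernel R P d * chcos R (delta_mx i 0) d)) <= _).
  apply: ler_avg => d; have w0 := kernel_ge0 R P d.
  have t0 i : 0 <= kappa^-1 * (kernel R P d - kernel R P d * chcos R (delta_mx i 0) d).
    rewrite mulr_ge0 ?invr_ge0 ?(ltW k0) // subr_ge0 ler_piMr //.
    exact: chcos_le1.
  have [_|/forallPn[i]] := boolP (near0 L d).
    by rewrite mulr0 sumr_ge0.
  rewrite negb_or -!leqNgt => /andP[Ld dL]; rewrite mulr1 (bigD1 i) //=.
  rewrite -[leLHS]addr0 lerD ?sumr_ge0 // ler_pdivlMl // chcos_delta.
  rewrite -[X in X - _]mulr1 -mulrBr mulrC ler_wpM2l // lerB //.
  exact: zcos_le Ld dL.
rewrite avg_sum /far_bound -mulrA [leRHS]mulr_natl.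
rewrite -[X in _ *+ X]card_ord -sumr_const.
apply: ler_sum => i _; rewrite avgZ mulrC ler_wpM2r ?invr_ge0 ?(ltW k0) //.
by rewrite avgB avg_kernel // avg_kernel_chcos; apply: hP; exact: imset_f.
Qed.

End Far.

(* The reduction of [{1 - L, ..., N + L}^k]. *)
Definition fat_cube (N L : nat) : {set T} :=
  [set \col_i ((f i)%:R + 1 - L%:R) | f : {ffun 'I_k -> 'I_(N + L.*2)}].

Lemma card_fat_cube N L : (#|fat_cube N L| <= (N + L.*2) ^ k)%N.
Proof. by rewrite (leq_trans (leq_imset_card _ _)) // card_ffun !card_ord. Qed.

Definition in_box (N : nat) x :=
  forall i, exists2 a : nat, (a < N)%N & x i 0 = a.+1%:R.

Lemma in_fat_cube N L y t : (L <= q.+2)%N ->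
  in_box N y -> near0 L t -> y + t \in fat_cube N L.
Proof.
move=> LQ yN tL.
have h i : exists b : 'I_(N + L.*2), (y + t) i 0 = (b : nat)%:R + 1 - L%:R.
  have [a aN ya] := yN i; rewrite !mxE ya.
  case/orP: (forallP tL i) => ht.
    have lt : (a + t i 0%R + L < N + L.*2)%N by rewrite -addnn; lia.
    exists (Ordinal lt); rewrite /= !natrD -natr1 natr_Zp.
    by rewrite [RHS]addrAC addrK addrAC.
  (* Here [t i 0] stands for the negative integer [t i 0 - Q], which is above [- L], so the
     truncated subtractions are exact. *)
  have lt : (a + L - (q.+2 - t i 0%R) < N + L.*2)%N by rewrite -addnn; lia.
  exists (Ordinal lt); rewrite /= natrB; last by have := ltn_ord (t i 0%R); lia.
  rewrite natrD natrB; last exact: ltnW (ltn_ord _).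
  rewrite natr_Zp -natr1 [q.+2%:R](_ : _ = 0); last first.
    exact: (pchar_Zp (isT : (1 < q.+2)%N)).
  by ring.
have [b hb] := fin_all_exists h.
apply/imsetP; exists [ffun i => b i] => //; apply/colP => i.
by rewrite [RHS]mxE ffunE -hb.
Qed.

Section Cube.
Variables (N L : nat) (e : R) (P : {set T}) (f : T -> R).
Hypotheses (LQ : (L <= q.+2)%N) (P0 : (0 < #|P|)%N).
Hypothesis far : \E_d (kernel R P d * (~~ near0 L d)%:R) <= e.
Hypothesis f01 : forall x, 0 <= f x <= 1.
Hypothesis fN : forall x, f x != 0 -> in_box N x.

Lemma near_weight : 1 - e <= \E_d (kernel R P d * (near0 L d)%:R).
Proof.
apply: le_trans (lerB (lexx 1) far) _; rewrite -[X in X - _](avg_kernel R P0) -avgB.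
by apply: ler_avg => d; case: near0; rewrite /= ?mulr1 ?mulr0 ?subr0 ?subrr.
Qed.

(** Smoothing spreads the mass at [y] over the points [y + t] with weight [kernel P t], and near
    shifts [t] stay in the fat cube. *)
Lemma smooth_fat_cube :
  (1 - e) * (\E_x f x) <= \E_x (smooth P f x * (x \in fat_cube N L)%:R).
Proof.
apply: le_trans (_ : \E_y (f y * \E_t (kernel R P t * (near0 L t)%:R)) <= _).
  rewrite mulrC -avgZr; apply: ler_avg => y; rewrite ler_wpM2l ?near_weight //.
  by case/andP: (f01 y).
have -> : \E_x (smooth P f x * (x \in fat_cube N L)%:R) =
    \E_y (f y * \E_t (kernel R P t * (t + y \in fat_cube N L)%:R)).
  transitivity (\E_x \E_y (f y * (kernel R P (x - y) * (x \in fat_cube N L)%:R))).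
    apply: eq_avg => x; rewrite smoothE -avgZr; apply: eq_avg => y.
    by rewrite mulrA.
  rewrite avgC; apply: eq_avg => y; rewrite avgZ; congr (_ * _).
  by rewrite (reindex_avg _ (addIr y)); apply: eq_avg => t /=; rewrite addrK.
apply: ler_avg => y; have [->|fy] := eqVneq (f y) 0; first by rewrite !mul0r.
have /andP[fy0 _] := f01 y; rewrite ler_wpM2l //; apply: ler_avg => t.
rewrite ler_wpM2l ?kernel_ge0 // ler_nat.
case: (boolP (near0 L t)) => // tL.
by rewrite addrC (in_fat_cube LQ (fN fy)).
Qed.

(* The tangent line bound [t ^ 3 >= 3 a ^ 2 t - 2 a ^ 3], summed over the fat
   cube. *)
Lemma smooth_cubed (a : R) : 0 <= a ->
  3 * a ^+ 2 * ((1 - e) * (\E_x f x))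
     - 2 * a ^+ 3 * (((N + L.*2) ^ k)%:R / #|{: T}|%:R)
  <= \E_x (smooth P f x ^+ 3).
Proof.
move=> a0.
have a2 : 0 <= 3 * a ^+ 2 by rewrite mulr_ge0 ?sqr_ge0.
have a3 : 0 <= 2 * a ^+ 3 by rewrite mulr_ge0 ?exprn_ge0.
apply: le_trans (_ : 3 * a ^+ 2 * (\E_x (smooth P f x * (x \in fat_cube N L)%:R))
  - 2 * a ^+ 3 * (\E_x (x \in fat_cube N L)%:R) <= _).
  apply: lerB; first by apply: (ler_wpM2l a2); exact: smooth_fat_cube.
  rewrite ler_wpM2l // avgE mulrC ler_wpM2r ?invr_ge0 //.
  have -> : \sum_x (x \in fat_cube N L)%:R = #|fat_cube N L|%:R :> R.
    rewrite -sum1_card natr_sum [RHS]big_mkcond.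
    by apply: eq_bigr => x _; case: (x \in _).
  by rewrite ler_nat card_fat_cube.
rewrite -!avgZ -avgB; apply: ler_avg => x.
have /andP[] := smooth_itv x P0 f01; move: (smooth P f x) => t t0 _.
case: (x \in _); last by rewrite !mulr0 subr0 exprn_ge0.
rewrite !mulr1 -subr_ge0.
have -> : t ^+ 3 - (3 * a ^+ 2 * t - 2 * a ^+ 3)
  = (t - a) ^+ 2 * (t + 2 * a) by ring.
by rewrite mulr_ge0 ?sqr_ge0 // addr_ge0 // mulr_ge0.
Qed.

End Cube.

(** Otherwise the weighted average is at most [X] from the near nonzero [d], plus [e] from the far
    ones, plus [kernel W 0 / #|T| = #|W| / #|T|] from [d = 0]. *)
Lemma popular_shift (L : nat) (e X : R) (W : {set T})
    (A B : 'M['I_q.+2]_k) (f : T -> R) :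
  (0 < #|W|)%N -> (forall x, 0 <= f x <= 1) -> 0 <= X ->
  \E_d (kernel R W d * (~~ near0 L d)%:R) <= e ->
  X + e + #|W|%:R / #|{: T}|%:R < form W A B f f f ->
  exists d, [/\ d != 0, near0 L d &
    X <= \E_x (f x * f (x + A *m d) * f (x + B *m d))].
Proof.
move=> W0 f01 X0 far big.
pose F d := \E_x (f x * f (x + A *m d) * f (x + B *m d)).
have [/existsP[d /and3P[]]|/existsPn no] :=
  boolP [exists d, [&& d != 0, near0 L d & X <= F d]].
  by exists d; split.
suff : form W A B f f f <= X + e + #|W|%:R / #|{: T}|%:R by rewrite leNgt big.
have F01 d : 0 <= F d <= 1.
  have f3 x : 0 <= f x * f (x + A *m d) * f (x + B *m d) <= 1.
    have /andP[a0 a1] := f01 x; have /andP[b0 b1] := f01 (x + A *m d).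
    have /andP[c0 c1] := f01 (x + B *m d).
    by rewrite !mulr_ge0 // !mulr_ile1 // mulr_ge0.
  rewrite /F avg_ge0 => [|x]; last by case/andP: (f3 x).
  rewrite -[leRHS](avg_cst _ (card_T_gt0 q k)); apply: ler_avg => x.
  by case/andP: (f3 x).
have -> : form W A B f f f = \E_d (kernel R W d * F d).
  by rewrite formE avgC; apply: eq_avg => d; rewrite avgZ.
apply: le_trans (_ : \E_d (kernel R W d * X + kernel R W d * (~~ near0 L d)%:R
   + kernel R W d * (d == 0)%:R) <= _).
  apply: ler_avg => d; rewrite -!mulrDr ler_wpM2l ?kernel_ge0 //.
  have /andP[F0 F1] := F01 d; move: (no d) F0 F1; move: (F d) => z.
  by case: (d == 0); case: (near0 L d); rewrite /= -?ltNge => *; lra.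
rewrite !avgD avgZr avg_kernel // mul1r; apply: lerD; first by rewrite lerD2l.
rewrite avgE (bigD1 0) //= eqxx mulr1 kernel0 // big1 => [|d /negPf->]; last first.
  by rewrite mulr0.
by rewrite addr0 mulrC.
Qed.

End Localisation.

(** * Choice of parameters and popular differences modulo [Q] *)

Lemma avg_indic (R : realType) (U : finType) (S : {set U}) :
  \E_x (x \in S)%:R = #|S|%:R / #|U|%:R :> R.
Proof.
rewrite avgE mulrC; congr (_ * _).
rewrite -sum1_card natr_sum [RHS]big_mkcond.
by apply: eq_bigr => x _; case: (x \in S).
Qed.

(** By convexity the power lies below its chord on [[0, 1]], of slope [2^k - 1]. *)
Lemma expr1D_le (R : realType) (x : R) (k : nat) : 0 <= x <= 1 ->
  (1 + x) ^+ k <= 1 + 2 ^+ k * x.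
Proof.
move=> /andP[x0 x1].
suff : (1 + x) ^+ k <= 1 + (2 ^+ k - 1) * x.
  by move=> h; apply: le_trans h _; rewrite lerD2l ler_wpM2r // lerBlDr lerDl.
elim: k => [|k IH]; first by rewrite !expr0 subrr mul0r addr0.
have k2 : 1 <= 2 ^+ k :> R by rewrite exprn_ege1 // ler1n.
rewrite [2 ^+ _]exprS [leLHS]exprS; move: IH k2.
move: ((1 + x) ^+ k) (2 ^+ k) => a b IH b1.
have h := mulr_ge0 (addr_ge0 ler01 x0); rewrite -subr_ge0 in IH.
have := h _ IH; have : 0 <= (b - 1) * (x * (1 - x)).
  by rewrite mulr_ge0 ?subr_ge0 // mulr_ge0 // subr_ge0.
by move=> *; lra.
Qed.

Lemma leq_div_double (N l : nat) : (0 < l)%N -> (2 * l <= N)%N ->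
  (N <= N %/ l * (2 * l))%N.
Proof. by move=> l0 lN; have := ltn_ceil N l0; move: (N %/ l)%N => L; nia. Qed.

Lemma double_div_leq (N l : nat) : ((N %/ l.+1).*2 * l <= 2 * N)%N.
Proof.
by have := leq_divM N l.+1; rewrite -muln2; move: (N %/ l.+1)%N => L; nia.
Qed.

(** [D], [E] and [F] are the densities of the cube, of the set and (as an upper bound) of the fat
    cube. The main term is [3 a^3 D - 2 a^3 D = a^3 D], and the losses add up to at most [11/16] of
    [eps * D]. *)
Lemma budget (R : realType) (a D e eps E F w : R) :
  0 <= a -> a <= 1 -> 0 < D -> D <= 1 -> 0 < e -> e <= 1 -> 0 < eps ->
  e <= eps * D ->
  a * D <= E -> F <= (1 + eps / 16) * D -> w <= e / 16 ->
  (a ^+ 3 - eps) * D + e / 16 + w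
    < 3 * a ^+ 2 * ((1 - e / 16) * E) - 2 * a ^+ 3 * F - 8 * (e / 32).
Proof.
move=> a0 a1 D0 D1 e0 e1 eps0 eD EE FF ww.
have a3 : 0 <= a ^+ 3 by rewrite exprn_ge0.
have a31 : a ^+ 3 <= 1 by rewrite expr_le1.
have h1 : 3 * a ^+ 2 * ((1 - e / 16) * (a * D)) <= 3 * a ^+ 2 * ((1 - e / 16) * E).
  by rewrite ler_wpM2l ?mulr_ge0 ?exprn_ge0 // ler_wpM2l // subr_ge0; lra.
have h2 : 2 * a ^+ 3 * F <= 2 * a ^+ 3 * ((1 + eps / 16) * D).
  by rewrite ler_wpM2l // mulr_ge0.
have h3 : a ^+ 3 * (D * eps) <= D * eps by rewrite ler_piMl // mulr_ge0 // ltW.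
have h4 : a ^+ 3 * (D * e) <= e.
  by rewrite mulrA; apply: ler_piMl (ltW e0) _; apply: mulr_ile1 => //; exact: ltW.
have h5 : 0 < eps * D by rewrite mulr_gt0.
have r1 : 3 * a ^+ 2 * ((1 - e / 16) * (a * D))
  = 3 * (a ^+ 3 * D) - 3 / 16 * (a ^+ 3 * (D * e)) by field.
have r2 : 2 * a ^+ 3 * ((1 + eps / 16) * D)
  = 2 * (a ^+ 3 * D) + 8^-1 * (a ^+ 3 * (D * eps)) by field.
have r3 : (a ^+ 3 - eps) * D = a ^+ 3 * D - D * eps by ring.
move: h1 h2 h3 h4 h5 eD; rewrite r1 r2 r3 [eps * D]mulrC.
move: (3 * a ^+ 2 * _) (2 * a ^+ 3 * _) => U V.
move: (a ^+ 3 * D) (a ^+ 3 * (D * e)) (a ^+ 3 * (D * eps)) (D * eps).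
by move=> b b1 b2 y; lra.
Qed.

Lemma popular_mod (R : realType) (k c : nat) (alpha eps : R) :
  (0 < k)%N -> (0 < c)%N -> 0 <= alpha -> alpha <= 1 -> 0 < eps ->
  exists N0 : nat, forall (q N : nat) (A B : 'M['I_q.+2]_k)
    (S : {set 'cV['I_q.+2]_k}),
    (N0 <= N)%N -> (N <= q.+2)%N -> (q.+2 <= c * N)%N ->
    A \in unitmx -> B \in unitmx -> A - B \in unitmx ->
    (forall x, x \in S -> in_box N x) -> alpha * N%:R ^+ k <= #|S|%:R ->
    exists d, [/\ d != 0, near0 N d & (alpha ^+ 3 - eps) * N%:R ^+ k <=
      #|[set x | [&& x \in S, x + A *m d \in S & x + B *m d \in S]]|%:R].
Proof.
move=> k0 c0 a0 a1 eps0.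
have [a_eps|eps_a] := ltP (alpha ^+ 3) eps.
  (* The target is negative, so any nonzero near [d] serves; [N >= 2] makes the all-ones vector near
     0. *)
  exists 2%N => q N A B S N2 NQ _ _ _ _ _ _.
  exists (const_mx 1); split.
  - by apply/cV0Pn; exists (Ordinal k0); rewrite mxE oner_eq0.
  - by apply/forallP => i; rewrite mxE /= N2.
  apply: le_trans (ler0n _ _); apply: mulr_le0_ge0; last exact: exprn_ge0.
  by rewrite subr_le0 ltW.
have eps1 : eps <= 1 by rewrite (le_trans eps_a) // expr_le1.
have c1 : 0 < c%:R :> R by rewrite ltr0n.
have ck : 0 < c%:R ^+ k :> R by rewrite exprn_gt0.
(* Errors are measured against the whole group, where the cube has density at least [c^(-k)] because
   [Q <= c * N]. *)
pose e' := eps / c%:R ^+ k.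
have e0 : 0 < e' by rewrite divr_gt0.
pose s := e' / 32.
have s0 : 0 < s by rewrite divr_gt0.
have k2 : 0 < 2 ^+ k :> R by rewrite exprn_gt0.
(* With [L = N %/ l.+2], fattening the cube by [L] enlarges its volume by a factor of at most
   [1 + eps / 16]; [lam] below is then a lower bound for [L / Q]. *)
have [l hl] : exists l : nat, l.+1%:R^-1 <= eps / 16 / (2 * 2 ^+ k) :> R.
  by apply: exists_inv_le; rewrite !divr_gt0 // mulr_gt0.
pose lam : R := (2 * l.+2%:R * c%:R)^-1.
have l0 : 0 < l.+2%:R :> R by rewrite ltr0n.
have lam0 : 0 < lam by rewrite invr_gt0 !mulr_gt0.
have lam2 : lam <= 2^-1.
  rewrite lef_pV2 ?posrE ?mulr_gt0 // -mulrA ler_peMr //.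
  by rewrite -natrM ler1n muln_gt0 c0.
have kap := kappa_gt0 lam0 lam2.
have [t1 ht1] : exists t : nat, t.+1%:R^-1 <= s ^+ 2 / 4.
  by apply: exists_inv_le; rewrite divr_gt0 ?exprn_gt0.
have kk0 : 0 < k%:R :> R by rewrite ltr0n.
have [t2 ht2] : exists t : nat, t.+1%:R^-1 <= e' / 16 * kappa lam / k%:R.
  by apply: exists_inv_le; rewrite divr_gt0 // mulr_gt0 // divr_gt0.
(* One precision for both uses: [t1] for the energy increment, [t2] for the localisation near 0. *)
pose m := maxn t1 t2.
have hm : m.+1%:R^-1 <= s ^+ 2 / 4.
  by rewrite (le_trans _ ht1) // lef_pV2 ?posrE ?ltr0n // ler_nat ltnS leq_maxl.
have hfar : far_bound k m lam <= e' / 16.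
  rewrite /far_bound ler_pdivrMr // mulrC -ler_pdivlMr //.
  by rewrite (le_trans _ ht2) // lef_pV2 ?posrE ?ltr0n // ler_nat ltnS leq_maxr.
have [C hC] := @regularity R k k m s s0 hm.
have C0 : 0 < C.+1%:R :> R by rewrite ltr0n.
have [t ht] : exists t : nat, t.+1%:R^-1 <= e' / 16 / C.+1%:R.
  by apply: exists_inv_le; rewrite !divr_gt0.
exists (maxn (2 * l.+2) t.+1) => q N A B S.
rewrite geq_max => /andP[Nl Nt] NQ Qc uA uB uAB boxS cardS.
pose L := (N %/ l.+2)%N.
have LN : (L <= N)%N by exact: leq_div.
have lamL : lam * q.+2%:R <= L%:R.
  rewrite mulrC ler_pdivrMr ?mulr_gt0 //.
  have : (q.+2 <= L * (2 * l.+2 * c))%N.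
    apply: leq_trans Qc _; rewrite mulnA [(c * N)%N]mulnC leq_mul2r.
    by rewrite leq_div_double ?orbT.
  by rewrite -(ler_nat R) !natrM.
pose f x : R := (x \in S)%:R.
have f01 x : 0 <= f x <= 1 by rewrite /f; case: (x \in S); rewrite lexx ler01.
have fN x : f x != 0 -> in_box N x.
  by rewrite /f; case: (boolP (x \in S)) => [/boxS//|_]; rewrite eqxx.
have [P [W [P0 W0 WC [hP hW] hform]]] :=
  hC q A B f _ uA uB uAB f01 (card_basis q k).
have farP := le_trans (far_weight lam0 lam2 lamL P0 hP) hfar.
have farW := le_trans (far_weight lam0 lam2 lamL W0 hW) hfar.
have LQ : (L <= q.+2)%N by exact: leq_trans LN NQ.
have cub := smooth_cubed LQ P0 farP f01 fN a0.
pose n : R := #|{: 'cV['I_q.+2]_k}|%:R.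
have nE : n = q.+2%:R ^+ k by rewrite /n card_mx card_ord muln1 natrX.
have n0 : 0 < n by rewrite nE exprn_gt0 // ltr0n.
pose D := N%:R ^+ k / n.
have N1 : (0 < N)%N by exact: leq_trans Nt.
have N0 : 0 < N%:R :> R by rewrite ltr0n.
have D0 : 0 < D by rewrite divr_gt0 // exprn_gt0.
have eD : e' <= eps * D.
  rewrite /e' ler_pM2l // /D ler_pdivlMr // ler_pdivrMl // nE -exprMn.
  by rewrite lerXn2r ?nnegrE ?mulr_ge0 // -natrM ler_nat.
have Ef : alpha * D <= \E_x f x.
  by rewrite avg_indic mulrA ler_wpM2r // invr_ge0 ltW.
have fat : ((N + L.*2) ^ k)%:R / n <= (1 + eps / 16) * D.
  rewrite /D mulrA ler_wpM2r ?invr_ge0 ?(ltW n0) //.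
  have x1 : L.*2%:R / N%:R <= 2 * l.+1%:R^-1 :> R.
    rewrite ler_pdivrMr // mulrAC ler_pdivlMr ?ltr0n //.
    by rewrite -!natrM ler_nat double_div_leq.
  have -> : ((N + L.*2) ^ k)%:R = (1 + L.*2%:R / N%:R) ^+ k * N%:R ^+ k :> R.
    by rewrite -exprMn mulrDl mul1r divfK ?gt_eqF // natrX natrD.
  rewrite ler_wpM2r ?exprn_ge0 //.
  apply: le_trans (expr1D_le _ _) _.
    rewrite divr_ge0 //= ler_pdivrMr // mul1r ler_nat -muln2.
    by rewrite (leq_trans _ (leq_divM N l.+2)) // leq_mul2l orbT.
  rewrite lerD2l mulrC -ler_pdivlMr //; apply: le_trans x1 _.
  have -> : eps / 16 / 2 ^+ k = 2 * (eps / 16 / (2 * 2 ^+ k)).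
    by field; rewrite gt_eqF.
  by rewrite ler_wpM2l.
have Wn : #|W|%:R / n <= e' / 16.
  rewrite ler_pdivrMr // mulrC; apply: le_trans (_ : C.+1%:R <= _).
    by rewrite ler_nat ltnW.
  apply: le_trans (_ : t.+1%:R * (e' / 16) <= _).
    by move: ht; rewrite ler_pdivlMr // ler_pdivrMl ?ltr0n.
  rewrite ler_wpM2r ?(ltW (divr_gt0 _ _)) // nE.
  apply: le_trans (_ : q.+2%:R <= _); first by rewrite ler_nat (leq_trans Nt).
  by rewrite ler_eXnr // ler1n.
have D1 : D <= 1.
  by rewrite ler_pdivrMr // mul1r nE lerXn2r ?nnegrE // ler_nat.
have e1 : e' <= 1 by rewrite (le_trans eD) // mulr_ile1 // ltW.
have X0 : 0 <= (alpha ^+ 3 - eps) * D by rewrite mulr_ge0 ?subr_ge0 // ltW.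
have big : (alpha ^+ 3 - eps) * D + e' / 16 + #|W|%:R / n < form W A B f f f.
  apply: lt_le_trans hform; rewrite -/n.
  apply: lt_le_trans (lerB cub (lexx _)).
  move: Ef fat Wn; rewrite -/n; move: (\E_x f x) (_%:R / n) (#|W|%:R / n).
  by move=> E F w; exact: budget.
have [d [dn0 dL dX]] := popular_shift W0 f01 X0 farW big.
exists d; split=> //.
  apply/forallP => i; have := forallP dL i; move: (nat_of_ord (d i 0)) LN NQ.
  by clear; lia.
move: dX; rewrite (eq_avg (g := fun x =>
  (x \in [set x | [&& x \in S, x + A *m d \in S & x + B *m d \in S]])%:R)).
  by rewrite avg_indic mulrA ler_pM2r // invr_gt0.
move=> x; rewrite inE /f.
case: (x \in S); case: (_ \in S); case: (_ \in S).
all: by rewrite /= ?mulr0 ?mul0r ?mulr1.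
Qed.

(** * Transfer to the integers *)

Section Reduction.
Variables (q k : nat).
Notation Z := 'I_q.+2.

Definition red (m n : nat) (M : 'M[int]_(m, n)) : 'M[Z]_(m, n) := map_mx intr M.

Lemma intr_inj_small (x y : int) : `|x - y| < q.+2%:Z ->
  x%:~R = y%:~R :> Z -> x = y.
Proof.
move=> lt /eqP; rewrite -subr_eq0 -intrB => /eqP z0.
apply/eqP; rewrite -subr_eq0; move: (x - y) lt z0 => z lt z0.
have e : (`|z|%N)%:R = 0 :> Z.
  by rewrite pmulrn abszEsg intrM z0 mulr0.
have : nat_of_ord ((`|z|%N)%:R : Z) = (`|z| %% q.+2)%N.
  exact: val_Zp_nat (isT : (1 < q.+2)%N) _.
rewrite e modn_small; last by lia.
by move/esym/eqP; rewrite absz_eq0.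
Qed.

(** The determinant divides [Q - 1], so [- w] is its inverse modulo [Q]. *)
Lemma red_unit (M : 'M[int]_k) (w : int) : \det M * w = q.+1%:Z -> red M \in unitmx.
Proof.
move=> h; rewrite unitmxE det_map_mx; apply/unitrP; exists (- w%:~R).
have e : (\det M)%:~R * w%:~R = -1 :> Z.
  rewrite -intrM h; apply/eqP; rewrite -subr_eq0 opprK natr1.
  by apply/eqP; exact: (pchar_Zp (isT : (1 < q.+2)%N)).
by rewrite mulrN mulNr mulrC e opprK.
Qed.

(** When [near0 N d] holds, both branches give a representative of absolute value at most [N]. *)
Definition lift0 (N : nat) (d : 'cV[Z]_k) : 'cV[int]_k :=
  \col_i (if (d i 0%R < N)%N then (d i 0 : nat)%:Z else (d i 0 : nat)%:Z - q.+2%:Z).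

Lemma red_lift0 N d : red (lift0 N d) = d.
Proof.
apply/colP => i; rewrite !mxE; case: ifP => _; first exact: natr_Zp.
rewrite intrB -pmulrn [X in _ - X](_ : _ = 0) ?subr0; first exact: natr_Zp.
exact: (pchar_Zp (isT : (1 < q.+2)%N)).
Qed.

Lemma lift0_le N d i : near0 N d -> `|lift0 N d i 0| <= N%:Z.
Proof.
move=> /forallP/(_ i); rewrite mxE; have := ltn_ord (d i 0).
by move: (nat_of_ord (d i 0)) => a; case: ifP; lia.
Qed.

End Reduction.

Definition entries_sum (k : nat) (M : 'M[int]_k) : int :=
  \sum_i \sum_j `|M i j|.

Lemma entries_sum_ge0 (k : nat) (M : 'M[int]_k) : 0 <= entries_sum M.
Proof. by apply: sumr_ge0 => i _; apply: sumr_ge0. Qed.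

Lemma mulmx_entry_le (k N : nat) (M : 'M[int]_k) (d : 'cV[int]_k) i :
  (forall j, `|d j 0| <= N%:Z) -> `|(M *m d) i 0| <= entries_sum M * N%:Z.
Proof.
move=> dN; rewrite mxE; apply: le_trans (ler_norm_sum _ _ _) _.
apply: le_trans (_ : (\sum_j `|M i j|) * N%:Z <= _).
  by rewrite mulr_suml; apply: ler_sum => j _; rewrite normrM ler_wpM2l.
rewrite ler_wpM2r // /entries_sum [leRHS](bigD1 i) //= lerDl.
by apply: sumr_ge0 => i' _; apply: sumr_ge0.
Qed.

Lemma card_cube k N : (#|` cube k N| <= N ^ k)%N.
Proof.
apply: leq_trans (leq_imfset_card _ _ _) _.
have -> : (N ^ k)%N = #|{: {ffun 'I_k -> 'I_N}}| by rewrite card_ffun !card_ord.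
by rewrite cardE.
Qed.

Lemma cube_bounds k N (x : 'cV[int]_k) i :
  x \in cube k N -> (1 <= x i 0) && (x i 0 <= N%:Z).
Proof. by rewrite in_cube => /forallP. Qed.

Section Transfer.
Variables (q k N : nat) (A : {fset 'cV[int]_k}).
Hypotheses (NQ : (N <= q.+2)%N) (AN : A `<=` cube k N).

Definition redset : {set 'cV['I_q.+2]_k} := [set red q (val a) | a : A].

Lemma redsetP x : reflect (exists2 a, a \in A & x = red q a) (x \in redset).
Proof.
apply: (iffP imsetP) => [[a _ ->]|[a aA ->]].
  by exists (val a) => //; exact: valP.
by exists [` aA].
Qed.

Lemma red_cube_inj a b : a \in A -> b \in A -> red q a = red q b -> a = b.
Proof.
move=> /(fsubsetP AN) aN /(fsubsetP AN) bN e; apply/colP => i.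
apply: (@intr_inj_small q); last by move/colP: e => /(_ i); rewrite !mxE.
have := cube_bounds i aN; have := cube_bounds i bN; move: (a i 0) (b i 0) => u v.
by move=> /andP[? ?] /andP[? ?]; lia.
Qed.

Lemma card_redset : #|redset| = #|` A|.
Proof.
rewrite card_imset ?cardfE // => a b; move/red_cube_inj => e.
by apply: val_inj; apply: e; exact: valP.
Qed.

Lemma redset_box x : x \in redset -> in_box N x.
Proof.
case/redsetP => a /(fsubsetP AN) aN -> i; rewrite mxE.
have := cube_bounds i aN; case: (a i 0) => [[|n]|n] // /andP[_ nN].
by exists n => //; rewrite pmulrn.
Qed.

(** No wrap-around: the lifted point and the point of [A] with the same reduction differ by less
    than [Q] in every coordinate. *)
Lemma lift_mem (M : 'M[int]_k) (d : 'cV['I_q.+2]_k) a :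
  near0 N d -> (entries_sum M + 1) * N%:Z < q.+2%:Z ->
  a \in A -> red q a + red q M *m d \in redset -> a + M *m lift0 N d \in A.
Proof.
move=> dN MQ aA /redsetP[b bA e].
suff -> : a + M *m lift0 N d = b by [].
have {}e : red q (a + M *m lift0 N d) = red q b.
  by rewrite -e /red map_mxD map_mxM -!/(red _ _) red_lift0.
have aN := fsubsetP AN _ aA; have bN := fsubsetP AN _ bA.
apply/colP => i; apply: (@intr_inj_small q).
  rewrite [(a + _) i 0]mxE.
  have := mulmx_entry_le M i (fun j => lift0_le j dN).
  have := cube_bounds i aN; have := cube_bounds i bN; move: MQ.
  rewrite mulrDl mul1r; move: (entries_sum M * N%:Z) => u.
  move: (a i 0) (b i 0) ((M *m _) i 0) => v w z.
  by move=> ? /andP[? ?] /andP[? ?]; lia.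
by move/colP: e => /(_ i); rewrite [LHS]mxE [RHS]mxE.
Qed.

Lemma card_pattern (M1 M2 : 'M[int]_k) (d : 'cV['I_q.+2]_k) :
  near0 N d ->
  (entries_sum M1 + 1) * N%:Z < q.+2%:Z -> (entries_sum M2 + 1) * N%:Z < q.+2%:Z ->
  (#|[set x | [&& x \in redset, (x + red q M1 *m d)%R \in redset
                & (x + red q M2 *m d)%R \in redset]]| <=
   #|` [fset x in cube k N | [&& x \in A, (x + M1 *m lift0 N d)%R \in A
                & (x + M2 *m lift0 N d)%R \in A]]|)%N.
Proof.
move=> dN h1 h2; rewrite [leqRHS]cardfE.
set X := [fset x in _ | _].
apply: leq_trans (leq_imset_card (fun a : X => red q (val a)) predT).
apply/subset_leq_card/subsetP => x; rewrite inE => /and3P[/redsetP[a aA ->] m1 m2].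
have aX : a \in X.
  by rewrite !inE /= (fsubsetP AN _ aA) aA !lift_mem.
by apply/imsetP; exists [` aX].
Qed.

End Transfer.

Theorem theorem1p1 (R : realType) (k : nat) (hk : (1 <= k)%N)
  (M1 M2 : 'M[int]_k)
  (hM1 : \det M1 != 0) (hM2 : \det M2 != 0) (hM12 : \det (M1 - M2) != 0)
  (alpha epsilon : R) (halpha : 0 < alpha) (hepsilon : 0 < epsilon) :
  exists N0 : nat, forall N : nat, (N0 <= N)%N ->
    forall A : {fset 'cV[int]_k},
      A `<=` cube k N ->
      alpha * N%:R ^+ k <= (#|` A|)%:R ->
      exists d : 'cV[int]_k,
        d != 0 /\
        (alpha ^+ 3 - epsilon) * N%:R ^+ k <=
          (#|` [fset x in cube k N |
                 [&& x \in A, x + M1 *m d \in A & x + M2 *m d \in A]]|)%:R.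
Proof.
have [alpha1|alpha1] := leP alpha 1; last first.
  (* For [alpha > 1] no subset of the cube is large enough. *)
  exists 1%N => N N1 A AN.
  have N0 : 0 < N%:R ^+ k :> R by rewrite exprn_gt0 // ltr0n.
  rewrite leNgt => /negP[]; apply: le_lt_trans (_ : N%:R ^+ k < _).
    by rewrite -natrX ler_nat (leq_trans (fsubset_leq_card AN)) ?card_cube.
  by rewrite ltr_pMl.
pose Delta := \det M1 * \det M2 * \det (M1 - M2).
have Delta0 : (0 < `|Delta|)%N by rewrite absz_gt0 !mulf_neq0.
have [K EK] : exists K : nat, K%:Z = entries_sum M1 + entries_sum M2 + 2.
  exists `|(entries_sum M1 + entries_sum M2 + 2)%R|%N.
  by rewrite gez0_abs // !addr_ge0 ?entries_sum_ge0.
have K0 : (0 < K)%N.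
  have := entries_sum_ge0 M1; have := entries_sum_ge0 M2; move: EK.
  by move: (entries_sum M1) (entries_sum M2) => a b; lia.
(* The modulus will be [|Delta| * K * N + 1]: it is 1 modulo each determinant, exceeds [K * N] to
   prevent wrap-around, and is at most [c * N]. *)
pose c := (`|Delta| * K + 1)%N.
have c0 : (0 < c)%N by rewrite /c addn1.
have [N0 hN0] := popular_mod hk c0 (ltW halpha) alpha1 hepsilon.
exists (maxn N0 1) => N; rewrite geq_max => /andP[N0N N1] A AN cardA.
have [q Eq] : exists q, q.+1 = (`|Delta| * K * N)%N.
  by exists (`|Delta| * K * N).-1; rewrite prednK // !muln_gt0 Delta0 K0.
have unit_dvd (M : 'M[int]_k) w : \det M * w = Delta -> red q M \in unitmx.
  move=> e; apply: (@red_unit _ _ _ (w * (sgz Delta * (K * N)%:Z))).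
  by rewrite mulrA e mulrA [Delta * _]mulrC -abszEsg -PoszM mulnA -Eq.
have u1 : red q M1 \in unitmx by apply: unit_dvd; rewrite /Delta -mulrA.
have u2 : red q M2 \in unitmx.
  apply: (unit_dvd _ (\det M1 * \det (M1 - M2))).
  by rewrite /Delta mulrA [in RHS](mulrC (\det M1)).
have u12 : red q M1 - red q M2 \in unitmx.
  rewrite /red -map_mxB -/(red _ _).
  by apply: (unit_dvd _ (\det M1 * \det M2)); rewrite mulrC.
have KQ : (K * N < q.+2)%N.
  by rewrite ltnS Eq -mulnA leq_pmull.
have NQ : (N <= q.+2)%N by rewrite (leq_trans _ (ltnW KQ)) ?leq_pmull.
have Qc : (q.+2 <= c * N)%N by rewrite Eq /c mulnDl mul1n -addn1 leq_add2l.
have small (M : 'M[int]_k) : entries_sum M + 1 <= K%:Z ->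
    (entries_sum M + 1) * N%:Z < q.+2%:Z.
  move=> le; apply: le_lt_trans (_ : K%:Z * N%:Z < _); first by rewrite ler_wpM2r.
  by rewrite -PoszM ltz_nat.
have s1 : (entries_sum M1 + 1) * N%:Z < q.+2%:Z.
  apply: small; rewrite EK; have := entries_sum_ge0 M2.
  by move: (entries_sum M1) (entries_sum M2) => a b; lia.
have s2 : (entries_sum M2 + 1) * N%:Z < q.+2%:Z.
  apply: small; rewrite EK; have := entries_sum_ge0 M1.
  by move: (entries_sum M1) (entries_sum M2) => a b; lia.
have [|d [d0 dN hd]] := hN0 q N (red q M1) (red q M2) (redset q A)
  N0N NQ Qc u1 u2 u12 (@redset_box _ _ _ _ AN).
  by rewrite (card_redset NQ AN).
exists (lift0 N d); split.
  by apply: contraNneq d0 => e; rewrite -(red_lift0 N d) e /red map_mx0 eqxx.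
apply: le_trans hd _; rewrite ler_nat; exact: card_pattern.
Qed.
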